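(* Let $d,k,n\ge 0$. For every $r\ge 1$ we have $$[A_{d,k}(n),\mathcal{E}_r(n)]\subset A_{d,k+r}(n),$$ that is, $u\cdot g-u\in A_{d,k+r}(n)$ for all $u\in A_{d,k}(n)$ and all $g\in\mathcal{E}_r(n)$.
   Context: $\mathbb K$ is a fixed field of characteristic $0$; $F_n$ is the free group on $x_1,\dots,x_n$; $\Gamma_r=\Gamma_r(F_n)$ is the $r$-th term of its lower central series ($\Gamma_1=F_n$). Andreadakis filtration of $\mathrm{End}(F_n)$: for $r\ge 0$, $\mathcal{E}_r(n)$ is the kernel of $\mathrm{End}(F_n)\to\mathrm{End}(F_n/\Gamma_{r+1})$, i.e. the submonoid of all $f$ with $f(x)x^{-1}\in\Gamma_{r+1}$ for all $x\in F_n$. Jacobi diagrams: $X_n$ is the disjoint union of $n$ oriented arcs numbered $1,\dots,n$. A Jacobi diagram on $X_n$ is a finite uni-trivalent graph $D$ with a cyclic order on the three half-edges at each trivalent vertex, whose univalent vertices are embedded in the interior of $X_n$ (up to orientation-preserving homeomorphisms of $X_n$ preserving each component), such that each connected component of $D$ has at least one univalent vertex. Its degree is half the number of vertices of $D$. $A_d(n)$ is the $\mathbb K$-vector space spanned by Jacobi diagrams of degree $d$ on $X_n$ modulo the STU relation: if a trivalent vertex has half-edges in cyclic order $(s,b,a)$ and the edge $s$ ends at a univalent vertex on $X_n$, then the diagram equals $D'-D''$, where $D'$ (resp. $D''$) is obtained by deleting this trivalent vertex and the edge $s$ and attaching $a,b$ to $X_n$ at two adjacent points near the former endpoint of $s$,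 with $a$ before $b$ (resp. $b$ before $a$) along the orientation. (STU implies the AS and IHX relations.) $A_{d,k}(n)\subset A_d(n)$ is the subspace spanned by diagrams with at least $k$ trivalent vertices. Action of $\mathrm{End}(F_n)$: for a homomorphism $f:F_n\to F_m$ the linear map $A_d(f):A_d(m)\to A_d(n)$ is defined as follows. Write $f(x_j)=x_{i_1}^{\epsilon_1}\cdots x_{i_l}^{\epsilon_l}$ with $\epsilon_p=\pm1$. For a diagram $D$ on $X_m$, the $j$-th arc of $X_n$ is formed by concatenating, along its orientation and starting with the rightmost letter, copies of the arcs numbered $i_l,\dots,i_1$ of $X_m$, the copy for $x_{i_p}^{\epsilon_p}$ being reversed if $\epsilon_p=-1$. $A_d(f)(D)$ is the sum over all ways of placing every univalent vertex of $D$ lying on arc $i$ at the corresponding point of one of the copies of arc $i$ (over all words), with sign $(-1)^{\#\{\text{vertices placed on reversed copies}\}}$. This is well defined, and $u\cdot g:=A_d(g)(u)$ is a right action of $\mathrm{End}(F_n)$ on $A_d(n)$. The bracket is $[u,g]:=u\cdot g-u$. *)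

(* Defs.v *)
From HB Require Import structures.
From mathcomp Require Import all_boot all_order all_algebra perm.
From mathcomp Require Import finmap boolp classical_sets.
From mathcomp.multinomials Require Import monalg.

Set Implicit Arguments.
Unset Strict Implicit.
Unset Printing Implicit Defensive.

Import GRing.Theory.

Local Open Scope ring_scope.
Local Open Scope quotient_scope.

(* The free group F_n as the group of reduced words: the letter (i, true) is  *)
(* x_i and (i, false) is x_i^-1.                                              *)
Section FreeGroup.
Variable n : nat.

Definition letter := ('I_n * bool)%type.
Implicit Types (a b : letter) (w : seq letter).

Definition linv a : letter := (a.1, ~~ a.2).

Definition reduced w := sorted (fun a b => b != linv a) w.

Record freegroup := FreeGroup { fgword :> seq letter; _ : reduced fgword }.

HB.instance Definition _ := [isSub for fgword].
HB.instance Definition _ := [Choice of freegroup by <:].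

(* Left multiplication of a reduced word by a letter.                         *)
Definition lmul a w :=
  if w is b :: w' then if b == linv a then w' else a :: w else [:: a].

Definition wmul w1 w2 := foldr lmul w2 w1.
Definition winv w := rev (map linv w).

Lemma linvK : involutive linv.
Proof. by case=> i b; rewrite /linv /= negbK. Qed.

Lemma linv_eq a b : (b == linv a) = (a == linv b).
Proof. by apply/eqP/eqP => ->; rewrite linvK. Qed.

Lemma reduced_lmul a w : reduced w -> reduced (lmul a w).
Proof.
case: w => [|b w] //= rw; case: ifPn => [_|ne]; last by rewrite /= ne.
exact: path_sorted rw.
Qed.

Lemma reduced_wmul w1 w2 : reduced w2 -> reduced (wmul w1 w2).
Proof. by move=> r2; elim: w1 => //= a w1 IH; exact: reduced_lmul. Qed.

Lemma reduced_winv w : reduced w -> reduced (winv w).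
Proof.
rewrite /reduced /winv rev_sorted sorted_map; apply: sub_sorted => a b /=.
by rewrite linvK eq_sym.
Qed.

Lemma lmulK a w : reduced w -> lmul a (lmul (linv a) w) = w.
Proof.
case: w => [|b w] /=; first by rewrite eqxx.
rewrite linvK; case: eqP => [->|_] r; last by rewrite /= eqxx.
by case: w r => [|c w] //= /andP[/negbTE-> _].
Qed.

Lemma wmul_lmul a w1 w2 : reduced w2 ->
  wmul (lmul a w1) w2 = lmul a (wmul w1 w2).
Proof.
move=> r2; case: w1 => [|b w1] //=; case: eqP => //= ->.
by rewrite lmulK // reduced_wmul.
Qed.

Lemma wmulA w1 w2 w3 : reduced w3 ->
  wmul w1 (wmul w2 w3) = wmul (wmul w1 w2) w3.
Proof. by move=> r3; elim: w1 => //= a w1 ->; rewrite wmul_lmul. Qed.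

Lemma wmulw0 w : reduced w -> wmul w [::] = w.
Proof.
elim: w => //= a w IH r; rewrite IH; last exact: path_sorted r.
by case: w r {IH} => //= b w /andP[/negbTE-> _].
Qed.

Lemma wmulVw w : reduced w -> wmul (winv w) w = [::].
Proof.
elim: w => //= a w IH r.
rewrite /winv map_cons rev_cons -cats1 /wmul foldr_cat /= linvK eqxx.
exact: IH (path_sorted r).
Qed.

Definition fg1 := @FreeGroup [::] isT.
Definition fgmul (u v : freegroup) := FreeGroup (reduced_wmul u (valP v)).
Definition fginv (u : freegroup) := FreeGroup (reduced_winv (valP u)).

Lemma fgmulA : associative fgmul.
Proof. by move=> u v w; apply/val_inj/wmulA/(valP w). Qed.

Lemma fgmul1g : left_id fg1 fgmul.
Proof. by move=> u; apply/val_inj. Qed.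

Lemma fgmulg1 : right_id fg1 fgmul.
Proof. by move=> u; apply/val_inj/wmulw0/(valP u). Qed.

Lemma fgmulVg : left_inverse fg1 fginv fgmul.
Proof. by move=> u; apply/val_inj/wmulVw/(valP u). Qed.

Lemma fgmulgV : right_inverse fg1 fginv fgmul.
Proof.
move=> u; have e : fginv (fginv u) = u.
  apply/val_inj; rewrite /= /winv map_rev revK mapK //; exact: linvK.
by rewrite -[X in fgmul X _]e fgmulVg.
Qed.

HB.instance Definition _ :=
  isGroup.Build freegroup fgmulA fgmul1g fgmulg1 fgmulVg fgmulgV.

Definition fggen (i : 'I_n) := @FreeGroup [:: (i, true)] isT.

End FreeGroup.

Arguments fggen {n} i.

Section LowerCentralSeries.
Variable G : groupType.
Local Open Scope group_scope.

Inductive subgroup_gen (S : set G) : set G :=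
| gen_in x of S x : subgroup_gen S x
| gen_one : subgroup_gen S 1
| gen_mul x y of subgroup_gen S x & subgroup_gen S y : subgroup_gen S (x * y)
| gen_inv x of subgroup_gen S x : subgroup_gen S x^-1.

Definition commutators (S T : set G) : set G :=
  [set z | exists x y, [/\ S x, T y & z = [~ x, y]]]%classic.

(* Gamma_1 = G and Gamma_(r+1) = [Gamma_r, G]; the value at r = 0 is junk.    *)
Definition lower_central (r : nat) : set G :=
  iter r.-1 (fun S => subgroup_gen (commutators S setT)) setT.

End LowerCentralSeries.

Definition andreadakis n (r : nat) :
    set {multiplicative freegroup n -> freegroup n} :=
  [set f | forall x, lower_central r.+1 (f x * x^-1)%g]%classic.

Section Span.
Variables (K : fieldType) (V : lmodType K) (S : set V).

Inductive lspan : set V :=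
| lspan0 : lspan 0
| lspanDZ a v w of S v & lspan w : lspan (a *: v + w).

Lemma lspanD v w : lspan v -> lspan w -> lspan (v + w).
Proof.
move=> sv sw; elim: sv => [|a x y Sx _ IH]; first by rewrite add0r.
by rewrite -addrA; apply: lspanDZ.
Qed.

Lemma lspanZ a v : lspan v -> lspan (a *: v).
Proof.
elim=> [|b x y Sx _ IH]; first by rewrite scaler0; apply: lspan0.
by rewrite scalerDr scalerA; apply: lspanDZ.
Qed.

Lemma lspan_sub v : S v -> lspan v.
Proof.
by move=> Sv; rewrite -[v]addr0 -[v]scale1r; apply: lspanDZ => //; apply: lspan0.
Qed.

Definition in_lspan : {pred V} := fun v => `[< lspan v >].

Lemma in_lspan_zmod_closed : zmod_closed in_lspan.
Proof.
split=> [|v w /asboolP sv /asboolP sw]; apply/asboolP; first exact: lspan0.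
by apply: lspanD => //; rewrite -scaleN1r; apply: lspanZ.
Qed.

HB.instance Definition _ := GRing.isZmodClosed.Build V in_lspan
  in_lspan_zmod_closed.

Definition quotient_by := {ideal_quot in_lspan}.

HB.instance Definition _ := GRing.Zmodule.on quotient_by.

Definition quotient_pi (v : V) : quotient_by := \pi_quotient_by v.

Local Notation pi := quotient_pi.

Lemma pi_eq v w : lspan (v - w) -> pi v = pi w.
Proof. by move=> s; apply/eqP; rewrite -Quotient.idealrBE; apply/asboolP. Qed.

Lemma lspan_repr v : lspan (v - repr (pi v)).
Proof.
have /esym/eqP := reprK (pi v).
by rewrite -[X in X == _]/(\pi_quotient_by v) -Quotient.idealrBE => /asboolP.
Qed.

Lemma pi_add v w : pi (v + w) = pi v + pi w.
Proof. exact: Quotient.pi_add. Qed.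

Definition quotient_scale (c : K) (u : quotient_by) : quotient_by :=
  pi (c *: repr u).

Lemma pi_scale c v : pi (c *: v) = quotient_scale c (pi v).
Proof. by apply: pi_eq; rewrite -scalerBr; apply/lspanZ/lspan_repr. Qed.

Lemma quotient_scaleA a b u :
  quotient_scale a (quotient_scale b u) = quotient_scale (a * b) u.
Proof.
elim/quotW: u => v; rewrite -/(pi v).
by rewrite -(pi_scale b v) -(pi_scale a (b *: v)) scalerA (pi_scale (a * b)).
Qed.

Lemma quotient_scale1 : left_id 1 quotient_scale.
Proof. by elim/quotW=> v; rewrite -/(pi v) -(pi_scale 1) scale1r. Qed.

Lemma quotient_scaleDr : right_distributive quotient_scale +%R.
Proof.
move=> a; elim/quotW=> v; elim/quotW=> w; rewrite -/(pi v) -/(pi w).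
rewrite -(pi_add v w) -(pi_scale a (v + w)) -(pi_scale a v).
by rewrite -(pi_scale a w) scalerDr (pi_add (a *: v)).
Qed.

Lemma quotient_scaleDl u : {morph quotient_scale^~ u : a b / a + b}.
Proof.
move=> a b; elim/quotW: u => v; rewrite -/(pi v).
rewrite -(pi_scale (a + b) v) -(pi_scale a v) -(pi_scale b v) scalerDl.
by rewrite (pi_add (a *: v)).
Qed.

HB.instance Definition _ := GRing.Zmodule_isLmodule.Build K quotient_by
  quotient_scaleA quotient_scale1 quotient_scaleDr quotient_scaleDl.

Lemma pi_is_linear : linear pi.
Proof. by move=> c v w; rewrite (pi_add (c *: v)) (pi_scale c v). Qed.

HB.instance Definition _ := GRing.isLinear.Build K V quotient_by _ pi
  pi_is_linear.

End Span.

(* A diagram is encoded by its half-edges, numbered 0, ..., N - 1:            *)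
(* - hrot maps a half-edge to the next one in the cyclic order at its vertex, *)
(*   so that vertices are orbits of hrot, the univalent ones being the fixed  *)
(*   points;                                                                  *)
(* - hflip maps a half-edge to the other half of its edge;                    *)
(* - legs i lists the univalent vertices on the i-th arc, along its           *)
(*   orientation.                                                             *)
Record prediagram (n : nat) := Prediagram {
  nhalf : nat;
  hrot : {perm 'I_nhalf};
  hflip : {perm 'I_nhalf};
  legs : {ffun 'I_n -> seq 'I_nhalf} }.

Section Prediagram.
Variable n : nat.

Definition prediagram_tag (P : prediagram n) :
    {N : nat & {perm 'I_N} * {perm 'I_N} * {ffun 'I_n -> seq 'I_N}}%type :=
  Tagged (fun N => {perm 'I_N} * {perm 'I_N} * {ffun 'I_n -> seq 'I_N})%type
    (hrot P, hflip P, legs P).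

Definition tag_prediagram
    (u : {N : nat & {perm 'I_N} * {perm 'I_N} * {ffun 'I_n -> seq 'I_N}}%type) :=
  let: existT N (r, f, l) := u in Prediagram r f l.

Lemma prediagram_tagK : cancel prediagram_tag tag_prediagram.
Proof. by case. Qed.

HB.instance Definition _ := Choice.copy (prediagram n) (can_type prediagram_tagK).

Variable P : prediagram n.

Definition adj : rel 'I_(nhalf P) :=
  fun h h' => (h' == hrot P h) || (h' == hflip P h).

Definition nvertices : nat := #|porbits (hrot P)|.

Definition ntrivalent : nat := #|[set v in porbits (hrot P) | #|v| == 3%N]|.

(* The conditions say that vertices have valency 1 or 3; that hflip is a      *)
(* fixed-point free involution; that every univalent vertex (and no other     *)
(* half-edge) occurs exactly once on the arcs; that every connected component *)
(* has a univalent vertex; and that the degree is d.                          *)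
Definition is_jacobi (d : nat) : bool :=
  [&& [forall h, #|porbit (hrot P) h| \in [:: 1%N; 3%N]],
      [forall h, (hflip P (hflip P h) == h) && (hflip P h != h)],
      [forall h, (\sum_i count_mem h (legs P i) == (hrot P h == h))%N],
      [forall h, exists l, (hrot P l == l) && connect adj h l]
    & nvertices == d.*2].

End Prediagram.

Record jacobi (n d : nat) := Jacobi {
  jdiag :> prediagram n; _ : is_jacobi jdiag d }.

HB.instance Definition _ n d := [isSub for @jdiag n d].
HB.instance Definition _ n d := [Choice of jacobi n d by <:].

Section Relations.
Variables (K : fieldType) (n d : nat).
Implicit Types D : jacobi n d.

Definition isomorphic D D' : Prop :=
  exists phi : 'I_(nhalf D') -> 'I_(nhalf D),
    [/\ bijective phi,
        forall h, phi (hrot D' h) = hrot D (phi h),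
        forall h, phi (hflip D' h) = hflip D (phi h)
      & forall i, map phi (legs D' i) = legs D i].

(* D' is obtained from D by deleting the edge {s, hflip s} together with its  *)
(* end vertices, the one of s being trivalent, that of hflip s univalent; the *)
(* other two half-edges hrot s and hrot (hrot s) become univalent, and l is   *)
(* inserted on the arc in place of the vertex of hflip s.                     *)
Definition resolution D (s : 'I_(nhalf D)) (l : seq 'I_(nhalf D)) D' : Prop :=
  exists iota : 'I_(nhalf D') -> 'I_(nhalf D),
    [/\ injective iota,
        forall h, (h \in codom iota) = (h \notin [:: s; hflip D s]),
        forall h, iota (hrot D' h) =
          if iota h \in [:: hrot D s; hrot D (hrot D s)] then iota h
          else hrot D (iota h),
        forall h, iota (hflip D' h) = hflip D (iota h)
      & forall i, map iota (legs D' i) =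
          flatten [seq if h == hflip D s then l else [:: h] | h <- legs D i]].

Inductive jacobi_relation : set {malg K[jacobi n d]} :=
| rel_iso D D' of isomorphic D D' : jacobi_relation (<< D >> - << D' >>)
| rel_STU D D' D'' (s : 'I_(nhalf D)) (b := hrot D s) (a := hrot D b)
    of b != s & hrot D (hflip D s) = hflip D s
     & resolution s [:: a; b] D' & resolution s [:: b; a] D'' :
    jacobi_relation (<< D >> - (<< D' >> - << D'' >>)).

Definition jacobi_space := quotient_by jacobi_relation.

HB.instance Definition _ := GRing.Lmodule.on jacobi_space.

Definition jacobi_class D : jacobi_space :=
  quotient_pi jacobi_relation << D >>.

Definition jacobi_filtration (k : nat) : set jacobi_space :=
  lspan [set u | exists2 D : jacobi n d, (k <= ntrivalent D)%N
                                      & u = jacobi_class D]%classic.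

End Relations.

(* Pulling back diagrams on X_m to diagrams on X_n along words w_0, ...,      *)
(* w_(n-1) in the generators of F_m and their inverses.                       *)
Section Cabling.
Variables (K : fieldType) (m n : nat) (w : 'I_n -> seq (letter m)).

(* The slot (j, p) is the copy of an arc of X_m that comes from the p-th      *)
(* letter of w j.                                                             *)
Definition slot := {j : 'I_n & 'I_(size (w j))}.

Definition slot_letter (s : slot) : letter m :=
  tnth (in_tuple (w (tag s))) (tagged s).

Section Legs.
Variables (T : Type) (L : 'I_m -> seq T) (c : T -> option slot).

(* The vertices placed on a slot, and then on a whole arc of X_n, in order.   *)
Definition slot_legs (s : slot) : seq T :=
  let: (i, e) := slot_letter s in
  let l := [seq h <- L i | c h == Some s] in
  if e then l else rev l.

Definition place_legs (j : 'I_n) : seq T :=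
  flatten [seq slot_legs (Tagged _ p) | p <- rev (enum 'I_(size (w j)))].

End Legs.

Section LegsTheory.

Lemma map_slot_legs (T T' : eqType) (phi : T -> T') (L : 'I_m -> seq T)
    (L' : 'I_m -> seq T') c c' s :
  (forall i, map phi (L i) = L' i) -> (forall h, c h = c' (phi h)) ->
  map phi (slot_legs L c s) = slot_legs L' c' s.
Proof.
move=> eL ec; rewrite /slot_legs; case: (slot_letter s) => i e.
rewrite -eL filter_map (eq_filter (a2 := fun h => c h == Some s)); last first.
  by move=> h /=; rewrite ec.
by case: e; rewrite ?map_rev.
Qed.

Lemma map_place_legs (T T' : eqType) (phi : T -> T') (L : 'I_m -> seq T)
    (L' : 'I_m -> seq T') c c' j :
  (forall i, map phi (L i) = L' i) -> (forall h, c h = c' (phi h)) ->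
  map phi (place_legs L c j) = place_legs L' c' j.
Proof.
move=> eL ec; rewrite /place_legs map_flatten -map_comp; congr flatten.
by apply: eq_map => p /=; apply: map_slot_legs.
Qed.

Lemma count_slot_legs (T : eqType) (L : 'I_m -> seq T) c s h :
  count_mem h (slot_legs L c s) =
    (if c h == Some s then count_mem h (L (slot_letter s).1) else 0)%N.
Proof.
rewrite /slot_legs; case: (slot_letter s) => i e /=.
transitivity (count_mem h [seq h <- L i | c h == Some s]).
  by case: e => //; rewrite count_rev.
rewrite count_filter; case: ifPn => ch.
  by apply: eq_count => x /=; case: eqP => //= ->.
by apply/eqP; rewrite eqn0Ngt -has_count; apply/hasPn=> x _ /=; case: eqP => // ->.
Qed.

Lemma count_place_legs (T : eqType) (L : 'I_m -> seq T) c h :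
  (\sum_j count_mem h (place_legs L c j))%N =
    (if c h is Some s then count_mem h (L (slot_letter s).1) else 0)%N.
Proof.
transitivity (\sum_(s : slot)
    (if c h == Some s then count_mem h (L (slot_letter s).1) else 0))%N.
  pose F j (p : 'I_(size (w j))) := let s := Tagged _ p : slot in
    (if c h == Some s then count_mem h (L (slot_letter s).1) else 0)%N.
  transitivity (\sum_j \sum_p F j p)%N; last first.
    by rewrite sig_big_dep /=; apply: eq_bigr; case.
  apply: eq_bigr => j _.
  rewrite /place_legs count_flatten -map_comp sumnE big_map big_rev.
  rewrite big_enum /=; apply: eq_bigr => p _; exact: count_slot_legs.
case: (c h) => [s|]; last by rewrite big1.
rewrite (bigD1 s) //= eqxx big1 ?addn0 // => s' /negbTE ne.
by case: eqP => // -[e]; rewrite e eqxx in ne.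
Qed.

End LegsTheory.

(* Ways of choosing a slot for every univalent vertex; the other half-edges   *)
(* get None.                                                                  *)
Definition placings (D : prediagram m) :
    {pred {ffun 'I_(nhalf D) -> option slot}} :=
  fun c => [forall h, if c h is Some s then h \in legs D (slot_letter s).1
                      else hrot D h != h].

Arguments placings : clear implicits.

Definition reversed (o : option slot) : bool :=
  if o is Some s then ~~ (slot_letter s).2 else false.

Definition place_sign N (c : 'I_N -> option slot) : K :=
  (-1) ^+ #|[pred h | reversed (c h)]|.

Definition preplace (D : prediagram m) (c : 'I_(nhalf D) -> option slot) :
    prediagram n :=
  Prediagram (hrot D) (hflip D) [ffun j => place_legs (legs D) c j].

Section Place.
Variables (d : nat) (D : jacobi m d).

Lemma preplace_jacobi (c : {ffun 'I_(nhalf D) -> option slot}) :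
  c \in placings D -> is_jacobi (preplace c) d.
Proof.
move=> /forallP cP.
have /and5P[e1 e2 e3 e4 e5] := valP D.
apply/and5P; split => //=; apply/forallP=> h /=.
under eq_bigr do rewrite ffunE.
rewrite count_place_legs; have := cP h; move/forallP: e3 => /(_ h).
case: (c h) => [s|] /eqP e; last by move=> /negbTE->.
move=> hs; have := e; rewrite (bigD1 (slot_letter s).1) //=.
have : (0 < count_mem h (legs D (slot_letter s).1))%N.
  by rewrite -has_count has_pred1.
case: (count_mem _ _) => // k _; rewrite addSn.
by case: (_ == h) => // -[/eqP]; rewrite addn_eq0 => /andP[/eqP->].
Qed.

Definition place (c : {c in placings D}) : jacobi n d :=
  Jacobi (preplace_jacobi (valP c)).

Definition cable_jacobi : jacobi_space K n d :=
  \sum_(c : {c in placings D}) place_sign (val c) *: jacobi_class K (place c).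

End Place.

Definition cable_malg d (v : {malg K[jacobi m d]}) : jacobi_space K n d :=
  \sum_(D <- msupp v) v@_D *: cable_jacobi D.

(* This does not depend on the representative, see cable_pi below.            *)
Definition cable d (u : jacobi_space K m d) : jacobi_space K n d :=
  cable_malg (repr u).

Section WellDefined.
Variable d : nat.
Implicit Types D : jacobi m d.

Definition preclass (P : prediagram n) : jacobi_space K n d :=
  if insub P is Some D then jacobi_class K D else 0.

Lemma preclassE P (h : is_jacobi P d) :
  preclass P = jacobi_class K (Jacobi h).
Proof. by rewrite /preclass insubT. Qed.

Lemma cable_jacobiE D : cable_jacobi D =
  \sum_(c in placings D) place_sign c *: preclass (preplace c).
Proof.
rewrite (big_sub (placings D)
  (fun c => place_sign c *: preclass (preplace c))).
by apply: eq_bigr => c _; rewrite (preclassE (preplace_jacobi (valP c))).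
Qed.

Lemma jacobi_class_iso q (D D' : jacobi q d) :
  isomorphic D D' -> jacobi_class K D = jacobi_class K D'.
Proof. by move=> iDD'; apply/pi_eq/lspan_sub/rel_iso. Qed.

Lemma jacobi_class_STU q (D D' D'' : jacobi q d) (s : 'I_(nhalf D))
    (b := hrot D s) (a := hrot D b) :
  b != s -> hrot D (hflip D s) = hflip D s ->
  resolution s [:: a; b] D' -> resolution s [:: b; a] D'' ->
  jacobi_class K D = jacobi_class K D' - jacobi_class K D''.
Proof.
move=> bs ts r1 r2; rewrite /jacobi_class -linearB; apply/pi_eq/lspan_sub.
exact: rel_STU bs ts r1 r2.
Qed.

Lemma cable_iso D D' : isomorphic D D' -> cable_jacobi D = cable_jacobi D'.
Proof.
case=> phi [bphi er ef el]; have [psi phiK psiK] := bphi.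
pose tr (c : {ffun 'I_(nhalf D) -> option slot}) :=
  [ffun h => c (phi h)] : {ffun 'I_(nhalf D') -> option slot}.
pose rt (c : {ffun 'I_(nhalf D') -> option slot}) :=
  [ffun h => c (psi h)] : {ffun 'I_(nhalf D) -> option slot}.
have trK : cancel tr rt by move=> c; apply/ffunP=> h; rewrite !ffunE psiK.
have rtK : cancel rt tr by move=> c; apply/ffunP=> h; rewrite !ffunE phiK.
have inj : injective phi by apply: can_inj phiK.
have pl c : (tr c \in placings D') = (c \in placings D).
  rewrite !unfold_in; apply/forallP/forallP => H h.
    have := H (psi h); rewrite ffunE psiK; case: (c h) => [s|].
      by rewrite -el -[h in X in _ -> X]psiK mem_map.
    by rewrite -(inj_eq inj) er psiK.
  have := H (phi h); rewrite ffunE; case: (c _) => [s|].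
    by rewrite -el mem_map.
  by rewrite -(inj_eq inj) er.
rewrite !cable_jacobiE [RHS](reindex tr); last first.
  by exists rt => c _; [apply: trK | apply: rtK].
apply: eq_big => [c|c cD]; first by rewrite pl.
have es : place_sign (tr c) = place_sign c.
  rewrite /place_sign -(on_card_preimset (f := phi)).
    by congr (_ ^+ _); apply: eq_card => h; rewrite !inE ffunE.
  by exists psi => h _.
have cD' : tr c \in placings D' by rewrite pl.
rewrite es (preclassE (preplace_jacobi cD)).
rewrite (preclassE (preplace_jacobi cD')).
apply: f_equal; apply: jacobi_class_iso; exists phi; split => //= i.
by rewrite !ffunE; apply: map_place_legs => // h; rewrite ffunE.
Qed.

Lemma place_signE N (c : 'I_N -> option slot) :
  place_sign c = \prod_h (-1) ^+ reversed (c h) :> K.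
Proof.
rewrite -expr_sum /place_sign -sum1_card big_mkcond /=; exact: congr1.
Qed.

Definition subst_seq (T : eqType) (t : T) (l L : seq T) : seq T :=
  flatten [seq if h == t then l else [:: h] | h <- L].

Lemma mem_subst_seq (T : eqType) (t : T) l L h :
  (h \in subst_seq t l L) = ((t \in L) && (h \in l)) || (h != t) && (h \in L).
Proof.
elim: L => //= [|g L IH]; first by rewrite andbF.
rewrite /subst_seq /= mem_cat -/(subst_seq _ _ _) IH !inE (eq_sym t).
case: (eqVneq g t) => [->|gt] /=.
  by case: (eqVneq h t) => //= _; case: (h \in l); case: (t \in L); rewrite /= ?orbF.
rewrite inE; case: (eqVneq h g) => [->|//]; by rewrite gt /= orbT.
Qed.

Lemma subst_seq_cat (T : eqType) (t : T) l L1 L2 :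
  subst_seq t l (L1 ++ L2) = subst_seq t l L1 ++ subst_seq t l L2.
Proof. by rewrite /subst_seq map_cat flatten_cat. Qed.

Lemma subst_seq_flatten (T : eqType) (t : T) l LL :
  subst_seq t l (flatten LL) = flatten [seq subst_seq t l L | L <- LL].
Proof. by elim: LL => //= L LL <-; rewrite subst_seq_cat. Qed.

Lemma subst_seq_rev (T : eqType) (t : T) l L :
  rev (subst_seq t l L) = subst_seq t (rev l) (rev L).
Proof.
elim: L => //= h L IH; rewrite rev_cons -cats1 subst_seq_cat -IH /subst_seq /= cats0.
by rewrite rev_cat; case: eqP.
Qed.

Lemma subst_seq_notin (T : eqType) (t : T) l L : t \notin L -> subst_seq t l L = L.
Proof.
elim: L => //= h L IH; rewrite inE negb_or eq_sym => /andP[/negbTE th /IH e].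
by rewrite /subst_seq /= th -/(subst_seq _ _ _) e.
Qed.

Lemma slot_legs_subst (T : eqType) (L : 'I_m -> seq T) (t t1 t2 : T)
    (x y : T -> option slot) sl :
    (forall i h, h \in L i -> h != t -> x h = y h) ->
    y t = Some sl -> x t1 = Some sl -> x t2 = Some sl ->
  forall s, slot_legs (fun i => subst_seq t [:: t1; t2] (L i)) x s =
    subst_seq t (if (slot_letter sl).2 then [:: t1; t2] else [:: t2; t1])
      (slot_legs L y s).
Proof.
move=> xy yt x1 x2 s.
have fE i : [seq h <- subst_seq t [:: t1; t2] (L i) | x h == Some s] =
    subst_seq t [:: t1; t2] [seq h <- L i | y h == Some s].
  have := xy i; elim: (L i) => //= h l IH xyh.
  rewrite {1}/subst_seq /= filter_cat -/(subst_seq _ _ _) IH; last first.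
    by move=> g gl; apply: xyh; rewrite inE gl orbT.
  case: (eqVneq h t) => [->|ht].
    rewrite /= x1 x2 yt; case: (Some sl == Some s) => //.
    by rewrite /subst_seq /= eqxx.
  have xh : x h = y h by apply: xyh; rewrite ?mem_head.
  rewrite /= xh; case: ifP => // _.
  by rewrite /subst_seq /= (negbTE ht).
rewrite /slot_legs; case es: (slot_letter s) => [i e] /=; rewrite fE.
case: (eqVneq s sl) => [<-|ssl].
  by rewrite es; case: e {es} => //=; rewrite subst_seq_rev.
have tn : t \notin [seq h <- L i | y h == Some s].
  by rewrite mem_filter yt negb_and; case: eqP => // -[E]; rewrite E eqxx in ssl.
case: e {es}; first by rewrite !subst_seq_notin.
by rewrite !subst_seq_notin // mem_rev.
Qed.

Lemma place_legs_subst (T : eqType) (L : 'I_m -> seq T) (t t1 t2 : T)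
    (x y : T -> option slot) sl :
    (forall i h, h \in L i -> h != t -> x h = y h) ->
    y t = Some sl -> x t1 = Some sl -> x t2 = Some sl ->
  forall j, place_legs (fun i => subst_seq t [:: t1; t2] (L i)) x j =
    subst_seq t (if (slot_letter sl).2 then [:: t1; t2] else [:: t2; t1])
      (place_legs L y j).
Proof.
move=> xy yt x1 x2 j; rewrite /place_legs subst_seq_flatten -map_comp.
congr flatten; apply: eq_map => p /=; exact: slot_legs_subst.
Qed.

Lemma place_legs_substC (T : eqType) (L : 'I_m -> seq T) (t t1 t2 : T)
    (x : T -> option slot) j :
  x t1 != x t2 -> place_legs (fun i => subst_seq t [:: t1; t2] (L i)) x j =
                  place_legs (fun i => subst_seq t [:: t2; t1] (L i)) x j.
Proof.
move=> x12; congr flatten; apply: eq_map => p; rewrite /slot_legs.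
case: (slot_letter _) => i e.
rewrite !filter_flatten -!map_comp.
suff -> : [seq [seq h <- (if g == t then [:: t1; t2] else [:: g]) |
    x h == Some (Tagged _ p)] | g <- L i] = [seq [seq h <-
    (if g == t then [:: t2; t1] else [:: g]) | x h == Some (Tagged _ p)]
    | g <- L i] by [].
apply: eq_map => g; case: ifP => //= _.
case: eqP => [e1|_]; case: eqP => [e2|_] //.
by rewrite e1 e2 eqxx in x12.
Qed.

Section STU.
Variables (D D' D'' : jacobi m d) (s : 'I_(nhalf D)).
Let b := hrot D s.
Let a := hrot D b.
Let t := hflip D s.
Hypotheses (bs : b != s) (rt : hrot D t = t).

Lemma hrot3 h : hrot D (hrot D (hrot D h)) = h.
Proof.
have /and5P[/forallP/(_ h) + _ _ _ _] := valP D.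
have := iter_porbit (hrot D) h; rewrite !inE.
by move=> + /orP[] /eqP c; rewrite c //= => e; rewrite !e.
Qed.

Let ra : hrot D a = s. Proof. exact: hrot3. Qed.
Let ab : a != b. Proof. by rewrite (inj_eq perm_inj). Qed.
Let as_ : a != s.
Proof. by apply: contraNneq bs => e; rewrite -[X in _ == X]ra e. Qed.
Let ts : t != s. Proof. by apply: contraNneq bs => e; rewrite /b -e rt e. Qed.
Let tb : t != b. Proof. by apply: contraNneq ab => e; rewrite /a -e rt e. Qed.
Let ta : t != a.
Proof. by apply: contraNneq as_ => e; rewrite -[X in _ == X]ra -e rt e. Qed.

Lemma legs_hrot (E : jacobi m d) i h : h \in legs E i -> hrot E h = h.
Proof.
move=> hi; have /and5P[_ _ /forallP/(_ h) + _ _] := valP E.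
rewrite (bigD1 i) //=; have : (0 < count_mem h (legs E i))%N.
  by rewrite -has_count has_pred1.
by case: (count_mem _ _) => // k _; case: (eqVneq (hrot E h) h).
Qed.

Let notleg i : [/\ s \notin legs D i, a \notin legs D i & b \notin legs D i].
Proof.
split; apply/negP=> /legs_hrot /eqP; rewrite -/b -/a ?ra ?(negbTE bs) //.
  by rewrite eq_sym (negbTE as_).
by rewrite (negbTE ab).
Qed.

Definition stu_placing (x : {ffun 'I_(nhalf D) -> option slot}) : bool :=
  [&& x s == None, x t == None & [forall h, (h \notin [:: s; t]) ==>
     if x h is Some sl then h \in subst_seq t [:: a; b] (legs D (slot_letter sl).1)
     else (h \notin [:: a; b]) && (hrot D h != h)]].

Definition stu_class (E : jacobi m d) (iota : 'I_(nhalf E) -> 'I_(nhalf D))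
    (x : {ffun 'I_(nhalf D) -> option slot}) : jacobi_space K n d :=
  preclass (preplace (fun g : 'I_(nhalf E) => x (iota g))).

Section Resolution.
Variables (E : jacobi m d) (iota : 'I_(nhalf E) -> 'I_(nhalf D)).
Variables (l : seq 'I_(nhalf D)).
Hypothesis lE : l =i [:: a; b].
Hypothesis inj : injective iota.
Hypothesis cod : forall h, (h \in codom iota) = (h \notin [:: s; t]).
Hypothesis er : forall h, iota (hrot E h) =
  if iota h \in [:: b; a] then iota h else hrot D (iota h).
Hypothesis el : forall i, map iota (legs E i) = subst_seq t l (legs D i).

Let res (x : {ffun 'I_(nhalf D) -> option slot}) :
  {ffun 'I_(nhalf E) -> option slot} := [ffun g => x (iota g)].
Let ext (c : {ffun 'I_(nhalf E) -> option slot}) :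
  {ffun 'I_(nhalf D) -> option slot} :=
  [ffun h => if [pick g | iota g == h] is Some g then c g else None].

Let resK c : res (ext c) = c.
Proof.
apply/ffunP=> g; rewrite !ffunE; case: pickP => [g' /eqP/inj->//|/(_ g)].
by rewrite eqxx.
Qed.

Lemma res_placing x :
  (res x \in placings E) && (ext (res x) == x) = stu_placing x.
Proof.
have iE g i : (g \in legs E i) = (iota g \in subst_seq t [:: a; b] (legs D i)).
  by rewrite -(mem_map inj) el !mem_subst_seq lE.
have rE g : (hrot E g != g) = (iota g \notin [:: a; b]) && (hrot D (iota g) != iota g).
  rewrite -(inj_eq inj) er.
  have -> : (iota g \in [:: a; b]) = (iota g \in [:: b; a]).
    by rewrite !inE orbC.
  by case: ifP => //=; rewrite eqxx.
have codP g : iota g \notin [:: s; t] by rewrite -cod codom_f.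
apply/andP/and3P.
  case=> /forallP H /eqP xE.
  have N h : h \in [:: s; t] -> x h == None.
    rewrite -xE ffunE; case: pickP => // g /eqP <-; by rewrite (negbTE (codP g)).
  split; [by apply: N; rewrite !inE eqxx | by apply: N; rewrite !inE eqxx orbT |].
  apply/forallP=> h; apply/implyP; rewrite -cod => /codomP[g ->].
  by have := H g; rewrite ffunE; case: (x _) => [sl|]; rewrite ?iE ?rE.
case=> /eqP xs /eqP xt /forallP H; split.
  apply/forallP=> g; have := H (iota g); rewrite codP /= ffunE.
  by case: (x _) => [sl|]; rewrite ?iE ?rE.
apply/eqP/ffunP=> h; rewrite ffunE; case: pickP => [g /eqP <-|no].
  by rewrite ffunE.
have : h \in [:: s; t].
  apply/negPn; rewrite -cod; apply/codomP => -[g e].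
  by have := no g; rewrite e eqxx.
by rewrite !inE => /orP[] /eqP->.
Qed.

Lemma placing_res x : stu_placing x -> res x \in placings E.
Proof. by rewrite -res_placing => /andP[]. Qed.

Lemma preplace_res x : stu_placing x ->
  is_jacobi (preplace (fun g : 'I_(nhalf E) => x (iota g))) d.
Proof.
move=> /placing_res /preplace_jacobi; congr is_jacobi.
congr Prediagram; apply/ffunP=> j; rewrite !ffunE.
by rewrite -[LHS]map_id; apply: map_place_legs => [i|g]; rewrite ?map_id ?ffunE.
Qed.

Lemma cable_res : cable_jacobi E =
  \sum_(x | stu_placing x) place_sign x *: stu_class iota x.
Proof.
rewrite cable_jacobiE.
rewrite (reindex_onto res ext (fun c _ => resK c)).
transitivity (\sum_(x | stu_placing x)
    place_sign (res x) *: preclass (preplace (res x))).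
  apply: eq_bigl => x; exact: res_placing.
apply: eq_bigr => x xP.
have -> : place_sign (res x) = place_sign x.
  rewrite !place_signE (bigID (fun h => h \in codom iota)) /=.
  rewrite [X in _ = _ * X]big1 ?mulr1; last first.
    move=> h; rewrite cod negbK !inE; case/and3P: xP => /eqP xs /eqP xt _.
    by case/orP=> /eqP ->; rewrite ?xs ?xt.
  pose iinv h := [pick g | iota g == h].
  have iK g : iinv (iota g) = Some g.
    by rewrite /iinv; case: pickP => [g' /eqP/inj->|/(_ g)/eqP].
  rewrite (reindex_omap iota iinv); last by move=> h /codomP[g ->]; rewrite iK.
  by apply: eq_big => g; rewrite ?ffunE // iK eqxx codom_f.
rewrite (preclassE (preplace_jacobi (placing_res xP))).
rewrite /stu_class (preclassE (preplace_res xP)).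
apply: f_equal; apply: jacobi_class_iso; exists id; split => //=; first by exists id.
move=> i; rewrite map_id !ffunE.
by rewrite -[LHS]map_id; apply: map_place_legs => [k|g]; rewrite ?map_id ?ffunE.
Qed.

End Resolution.

Let up (y : {ffun 'I_(nhalf D) -> option slot}) :
    {ffun 'I_(nhalf D) -> option slot} :=
  [ffun h => if h \in [:: a; b] then y t else if h \in [:: s; t] then None
             else y h].

Let down (x : {ffun 'I_(nhalf D) -> option slot}) :
    {ffun 'I_(nhalf D) -> option slot} :=
  [ffun h => if h == t then x a else if h \in [:: s; a; b] then None else x h].

Let eqs := (eqxx, negbTE ab, negbTE as_, negbTE ts, negbTE tb, negbTE ta,
  negbTE bs, eq_sym b a, eq_sym s a, eq_sym s t, eq_sym b t, eq_sym a t,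
  eq_sym s b).

Let upa y : up y a = y t. Proof. by rewrite ffunE !inE eqxx. Qed.
Let upb y : up y b = y t. Proof. by rewrite ffunE !inE eqxx orbT. Qed.

Lemma stu_up x : stu_placing x -> x a == x b -> up (down x) = x.
Proof.
move=> /and3P[/eqP xs /eqP xt _] /eqP xab; apply/ffunP=> h.
rewrite !ffunE eqxx !inE; case: (eqVneq h a) => [->|ha] //=.
case: (eqVneq h b) => [->|hb] //=.
case: (eqVneq h s) => [->|hs] //=.
by case: (eqVneq h t) => [->|ht].
Qed.

Lemma placing_none y h : y \in placings D -> h \in [:: s; a; b] -> y h = None.
Proof.
move=> /forallP/(_ h); case: (y h) => // sl; have [ns na nb] := notleg (slot_letter sl).1.
by move=> hl; rewrite !inE => /or3P[]/eqP e; move: hl; rewrite e ?(negbTE ns) ?(negbTE na) ?(negbTE nb).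
Qed.

Lemma placing_t y : y \in placings D ->
  exists2 sl, y t = Some sl & t \in legs D (slot_letter sl).1.
Proof.
by move=> /forallP/(_ t); case: (y t) => [sl|]; [exists sl | rewrite rt eqxx].
Qed.

Lemma up_placing y :
  (stu_placing (up y) && (up y a == up y b)) && (down (up y) == y) =
  (y \in placings D).
Proof.
apply/andP/idP.
  case=> /andP[/and3P[_ _ /forallP H] _] /eqP yE.
  rewrite unfold_in; apply/forallP=> h.
  case: (eqVneq h t) => [->|ht].
    have := H a; rewrite upa !inE !eqs /=; case: (y t) => // sl.
    have [_ na _] := notleg (slot_letter sl).1.
    by rewrite mem_subst_seq (negbTE na) andbF orbF => /andP[].
  have := H h; rewrite -[in X in _ -> X]yE [down _ h]ffunE (negbTE ht) !inE.
  rewrite (negbTE ht) orbF.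
  case: (eqVneq h s) => [-> _|hs /=]; first by rewrite -/b.
  case: (eqVneq h a) => [-> _ /=|ha /=]; first by rewrite ra eq_sym.
  case: (eqVneq h b) => [-> _ /=|hb /=]; first by rewrite -/a.
  case: (up y h) => // sl; rewrite mem_subst_seq !inE (negbTE ha) (negbTE hb) ht.
  by rewrite /= andbF.
move=> yP; have [sl yt tl] := placing_t yP; split; last first.
  apply/eqP/ffunP=> h; rewrite ffunE upa.
  case: (eqVneq h t) => [->|ht] //; case: ifP => [/(placing_none yP)->//|].
  move=> /negbT; rewrite ffunE !inE !negb_or => /and3P[/negbTE-> /negbTE-> /negbTE->].
  by rewrite (negbTE ht).
rewrite upa upb eqxx andbT; apply/and3P; split.
- by rewrite ffunE !inE !eqs.
- by rewrite ffunE !inE !eqs.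
apply/forallP=> h; apply/implyP; rewrite !inE negb_or => /andP[hs ht].
rewrite ffunE !inE (negbTE hs) (negbTE ht) /=.
case: ifP => [hab|/negbT hab].
  by rewrite yt mem_subst_seq tl !inE hab.
move/forallP: yP => /(_ h); case: (y h) => [sl'|] //.
by rewrite mem_subst_seq ht => ->; rewrite orbT.
Qed.

Lemma cable_STU :
  resolution s [:: a; b] D' -> resolution s [:: b; a] D'' ->
  cable_jacobi D = cable_jacobi D' - cable_jacobi D''.
Proof.
move=> [i1 [inj1 cod1 er1 ef1 el1]] [i2 [inj2 cod2 er2 ef2 el2]].
have lC : [:: b; a] =i [:: a; b] by move=> h; rewrite !inE orbC.
have jac1 := preplace_res (fun=> erefl) inj1 cod1 er1 el1.
have jac2 := preplace_res lC inj2 cod2 er2 el2.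
rewrite (cable_res (fun=> erefl) inj1 cod1 er1 el1).
rewrite (cable_res lC inj2 cod2 er2 el2) -sumrB.
rewrite (bigID (fun x : {ffun _} => x a == x b)) /= [X in _ + X]big1 ?addr0.
  rewrite (reindex_onto up down); last first.
    by move=> x /andP[]; apply: stu_up.
  rewrite cable_jacobiE; apply: eq_big => y; first by rewrite up_placing.
  move=> yP; have [sl yt tl] := placing_t yP.
  have /andP[/andP[xP _] _] : (stu_placing (up y) && (up y a == up y b)) &&
    (down (up y) == y) by rewrite up_placing.
  have xy i h : h \in legs D i -> h != t -> up y h = y h.
    move=> hl ht; rewrite ffunE !inE (negbTE ht) orbF.
    have [ns na nb] := notleg i.
    case: eqP => [e|_]; first by rewrite -e hl in na.
    case: eqP => [e|_]; first by rewrite -e hl in nb.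
    by case: eqP => [e|_] //; rewrite -e hl in ns.
  have xa : up y a = Some sl by rewrite upa.
  have xb : up y b = Some sl by rewrite upb.
  have lE (E : jacobi m d) (iota : 'I_(nhalf E) -> 'I_(nhalf D)) t1 t2 :
      (forall i, map iota (legs E i) = subst_seq t [:: t1; t2] (legs D i)) ->
      up y t1 = Some sl -> up y t2 = Some sl ->
      forall j, map iota (place_legs (legs E) (fun g => up y (iota g)) j) =
        subst_seq t (if (slot_letter sl).2 then [:: t1; t2] else [:: t2; t1])
          (place_legs (legs D) y j).
    move=> el x1 x2 j; rewrite -(place_legs_subst xy yt x1 x2).
    exact: map_place_legs.
  have sgn : place_sign y =
      (if (slot_letter sl).2 then 1 else -1) * place_sign (up y).
    have [yn yr] : (forall h, h \in [:: s; a; b] -> y h = None) /\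
        forall h, h != t -> h != a -> h != b -> up y h = y h.
      split=> [h|h ht ha hb]; first exact: placing_none.
      rewrite ffunE !inE (negbTE ht) (negbTE ha) (negbTE hb) orbF /=.
      by case: eqP => // ->; rewrite (placing_none yP) ?mem_head.
    have upt : up y t = None by rewrite ffunE !inE !eqs.
    rewrite !place_signE (bigD1 t) //= (bigD1 a) /= 1?eq_sym //.
    rewrite (bigD1 b) /=; last by rewrite !(eq_sym b) tb ab.
    rewrite [in RHS](bigD1 t) //= [in RHS](bigD1 a) /=; last by rewrite eq_sym.
    rewrite [in RHS](bigD1 b) /=; last by rewrite !(eq_sym b) tb ab.
    rewrite upt xa xb yt !yn ?inE ?eqxx ?orbT //= !expr0 !mul1r.
    under [in RHS]eq_bigr => h /andP[/andP[ht ha] hb] do rewrite yr //.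
    case: (slot_letter sl).2 => /=; first by rewrite !expr0 !mul1r.
    by rewrite !expr1 mulrA !mulN1r opprK mul1r.
  rewrite sgn /stu_class (preclassE (preplace_jacobi yP)).
  rewrite (preclassE (jac1 _ xP)) (preclassE (jac2 _ xP)).
  have := lE _ _ _ _ el1 xa xb; have := lE _ _ _ _ el2 xb xa.
  case: (slot_letter sl).2 => l2 l1.
    rewrite mul1r -scalerBr; apply: f_equal.
    apply: (@jacobi_class_STU n (Jacobi (preplace_jacobi yP)) _ _ s) => //.
      by exists i1; split=> // j; rewrite !ffunE; apply: l1.
    by exists i2; split=> // j; rewrite !ffunE; apply: l2.
  have opp (V : lmodType K) (p : K) (u v : V) :
      (-1 * p) *: (u - v) = p *: v - p *: u.
    by rewrite mulN1r scaleNr -scalerN opprB scalerBr.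
  rewrite -opp; apply: f_equal.
  apply: (@jacobi_class_STU n (Jacobi (preplace_jacobi yP)) _ _ s) => //.
    by exists i2; split=> // j; rewrite !ffunE; apply: l2.
  by exists i1; split=> // j; rewrite !ffunE; apply: l1.
move=> x /andP[xP xab].
rewrite /stu_class (preclassE (jac1 _ xP)) (preclassE (jac2 _ xP)).
have ex (E F : jacobi m d) (i : 'I_(nhalf E) -> 'I_(nhalf D)) j :
    (forall h, (h \in codom i) = (h \notin [:: s; hflip D s])) ->
    (forall h, (h \in codom j) = (h \notin [:: s; hflip D s])) ->
    exists f : 'I_(nhalf F) -> 'I_(nhalf E), forall h, i (f h) = j h.
  move=> ci cj; apply: (fin_all_exists (P := fun h g => i g = j h)) => h.
  have : j h \in codom i by rewrite ci -cj codom_f.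
  by case/codomP=> g ->; exists g.
have [phi phiE] := ex _ _ _ _ cod1 cod2.
have [psi psiE] := ex _ _ _ _ cod2 cod1.
apply/eqP; rewrite -scalerBr; apply/eqP.
suff -> : jacobi_class K (Jacobi (jac1 x xP)) = jacobi_class K (Jacobi (jac2 x xP)).
  by rewrite subrr scaler0.
apply: jacobi_class_iso; exists phi; split => /=.
- exists psi => h; first by apply: inj2; rewrite psiE phiE.
  by apply: inj1; rewrite phiE psiE.
- by move=> h; apply: inj1; rewrite phiE er2 er1 phiE !inE orbC.
- by move=> h; apply: inj1; rewrite phiE ef2 ef1 phiE.
move=> j; rewrite !ffunE; apply: (inj_map inj1); rewrite -map_comp.
rewrite (eq_map (g := i2)); last by move=> h /=; rewrite phiE.
rewrite (map_place_legs (c' := x) _ el2) // (map_place_legs (c' := x) _ el1) //.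
by rewrite -!/(subst_seq _ _ _); apply/esym/place_legs_substC.
Qed.

End STU.

Lemma cable_malgEw (v : {malg K[jacobi m d]}) (S : {fset jacobi m d}) :
  (msupp v `<=` S)%fset -> cable_malg v = \sum_(D <- S) v@_D *: cable_jacobi D.
Proof.
move=> sub; rewrite /cable_malg (big_fset_incl _ sub) // => D _ nD.
by rewrite mcoeff_outdom // scale0r.
Qed.

Lemma cable_malg_is_linear : linear (@cable_malg d).
Proof.
move=> c v u; pose S := (msupp v `|` msupp u)%fset.
have sv : (msupp v `<=` S)%fset by apply: fsubsetUl.
have su : (msupp u `<=` S)%fset by apply: fsubsetUr.
have sD : (msupp (c *: v + u)%R `<=` S)%fset.
  apply: fsubset_trans (msuppD_le _ _) _; apply: fsetSU; exact: msuppZ_le.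
rewrite (cable_malgEw sv) (cable_malgEw su) (cable_malgEw sD).
rewrite scaler_sumr -big_split /=; apply: eq_bigr => D _.
by rewrite mcoeffD mcoeffZ scalerDl scalerA.
Qed.

HB.instance Definition _ := GRing.isLinear.Build K {malg K[jacobi m d]}
  (jacobi_space K n d) _ (@cable_malg d) cable_malg_is_linear.

Lemma cable_malgB (v u : {malg K[jacobi m d]}) :
  cable_malg (v - u) = cable_malg v - cable_malg u.
Proof. exact: raddfB. Qed.

Lemma cable_malgU D : cable_malg << D >> = cable_jacobi D.
Proof. by rewrite (cable_malgEw msuppU_le) big_seq_fset1 mcoeffUU scale1r. Qed.

Lemma cable_malg_rel (v : {malg K[jacobi m d]}) :
  jacobi_relation v -> cable_malg v = 0.
Proof.
case=> [D D' iDD'|D D' D'' s b a bs ts r1 r2].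
  apply: etrans (cable_malgB _ _) _.
  apply: etrans (f_equal2 _ (cable_malgU D)
    (f_equal _ (cable_malgU D'))) _.
  by rewrite (cable_iso iDD') subrr.
apply: etrans (cable_malgB _ _) _.
apply: etrans (f_equal2 _ (cable_malgU D) (f_equal _ (cable_malgB _ _))) _.
apply: etrans (f_equal (fun u => _ - u) (f_equal2 _ (cable_malgU D')
  (f_equal _ (cable_malgU D'')))) _.
by rewrite (cable_STU bs ts r1 r2) subrr.
Qed.

Lemma cable_pi (v : {malg K[jacobi m d]}) :
  cable (quotient_pi (@jacobi_relation K m d) v) = cable_malg v.
Proof.
have : forall u, lspan (@jacobi_relation K m d) u -> cable_malg u = 0.
  move=> u; elim=> [|c x y rx _ IH]; first by rewrite linear0.
  by rewrite linearP /= cable_malg_rel // IH scaler0 addr0.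
move=> /(_ _ (lspan_repr (@jacobi_relation K m d) v)) /eqP.
by rewrite cable_malgB subr_eq0 => /eqP->.
Qed.

Lemma cable_class D : cable (jacobi_class K D) = cable_jacobi D.
Proof. exact: etrans (cable_pi _) (cable_malgU D). Qed.

Lemma cable_is_linear : linear (@cable d).
Proof.
move=> c; elim/quotW=> v; elim/quotW=> u.
rewrite -/(quotient_pi (@jacobi_relation K m d) v).
rewrite -/(quotient_pi (@jacobi_relation K m d) u).
by rewrite -linearP !cable_pi linearP.
Qed.

HB.instance Definition _ := GRing.isLinear.Build K (jacobi_space K m d)
  (jacobi_space K n d) _ (@cable d) cable_is_linear.

End WellDefined.
End Cabling.

(* A_d(f) : A_d(m) -> A_d(n) for f : F_n -> F_m.                              *)
Definition jacobi_map (K : fieldType) (m n d : nat)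
    (f : {multiplicative freegroup n -> freegroup m})
    (u : jacobi_space K m d) : jacobi_space K n d :=
  cable (fun j => fgword (f (fggen j))) u.

Definition bracket (K : fieldType) (n d : nat) (u : jacobi_space K n d)
    (g : {multiplicative freegroup n -> freegroup n}) : jacobi_space K n d :=
  jacobi_map g u - u.

(* Main.v *)
(** Write the legs of a diagram D on an arc as noncommuting letters l, and send
    a generator x_i to the product of the 1 + l over the legs l on arc i.
    Placing the legs of D along words w_j is then the expansion of the product
    of the images of the w_j: an additive evaluation map, which kills words that
    are not multilinear, turns it into the pullback of D.  Modulo repeated
    letters, x_i^-1 goes to the reversed product of the 1 - l, so that the
    construction factors through the free group.

    Filter the free ring by F_p, spanned by the products of iterated commutators
    of letters in which at least p brackets occur.  Then F_p F_q lies in F_(p+q)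
    and [F_p, F_q] in F_(p+q+1); hence the image of Gamma_(r+1) lies in 1 + F_r,
    and replacing x_j by g(x_j) changes the product of images by an element of
    F_r.  By STU, evaluating an innermost commutator [a, b] amounts to joining
    the legs a and b at a new trivalent vertex, so that evaluation maps F_p to
    combinations of diagrams with p more trivalent vertices than D. *)

Require Import Defs.
From HB Require Import structures.
From mathcomp Require Import all_boot all_order all_algebra.
From mathcomp Require Import fingroup perm action finmap.
From mathcomp Require classical_sets.
From mathcomp.multinomials Require Import monalg.

Set Implicit Arguments.
Unset Strict Implicit.
Unset Printing Implicit Defensive.

Import GRing.Theory.

Local Open Scope ring_scope.

(** * Commutator filtration of a ring *)

Section SignedSpan.
Variable V : pzRingType.
Implicit Types (S T U : V -> Prop) (x y z : V).

(** This is the additive subgroup generated by [S]. The ring carries no field of scalars, so the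
    coefficients are signs, and repetition supplies the other integers. *)
Inductive zspan S : V -> Prop :=
| zspan0 : zspan S 0
| zspanDZ (e : bool) x z of S x & zspan S z : zspan S ((-1) ^+ e * x + z).

Lemma zspan_sub S x : S x -> zspan S x.
Proof.
move=> Sx; have := zspanDZ false Sx (zspan0 S).
by rewrite expr0 mul1r addr0.
Qed.

Lemma zspanD S x y : zspan S x -> zspan S y -> zspan S (x + y).
Proof.
move=> sx sy; elim: sx => [|e u z Su _ IH]; first by rewrite add0r.
by rewrite -addrA; apply: zspanDZ.
Qed.

Lemma zspan_sign S (e : bool) x : zspan S x -> zspan S ((-1) ^+ e * x).
Proof.
elim=> [|e' u z Su _ IH]; first by rewrite mulr0; apply: zspan0.
by rewrite mulrDr mulrA -signr_addb; apply: zspanDZ.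
Qed.

Lemma zspanN S x : zspan S x -> zspan S (- x).
Proof. by move/(zspan_sign true); rewrite expr1 mulN1r. Qed.

Lemma zspanB S x y : zspan S x -> zspan S y -> zspan S (x - y).
Proof. by move=> sx /zspanN; apply: zspanD. Qed.

Lemma zspan_trans S T x : (forall y, S y -> zspan T y) -> zspan S x -> zspan T x.
Proof.
move=> sub; elim=> [|e y z /sub sy _ IH]; first exact: zspan0.
exact/zspanD/IH/zspan_sign.
Qed.

Lemma zspan_mul S T U x y :
    (forall u v, S u -> T v -> zspan U (u * v)) ->
  zspan S x -> zspan T y -> zspan U (x * y).
Proof.
move=> ST sx sy; elim: sx => [|e u z Su _ IH].
  by rewrite mul0r; apply: zspan0.
rewrite mulrDl -mulrA; apply/zspanD/IH/zspan_sign => {IH z}.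
elim: sy => [|e' v z Tv _ IH]; first by rewrite mulr0; apply: zspan0.
rewrite mulrDr mulrA [u * _]commr_sign -mulrA.
by apply/zspanD/IH/zspan_sign/ST.
Qed.

End SignedSpan.

(** * Iterated commutators as binary trees, and their products as forests *)

Inductive tree (X : Type) := Leaf of X | Node of tree X & tree X.

Arguments Leaf {X} x.

Section Trees.
Variable X : Type.
Implicit Types (t : tree X) (ts : seq (tree X)).

Fixpoint leaves t : seq X :=
  if t is Node t1 t2 then leaves t1 ++ leaves t2 else
  if t is Leaf x then [:: x] else [::].

Fixpoint nodes t : nat :=
  if t is Node t1 t2 then (nodes t1 + nodes t2).+1 else 0.

Definition fleaves ts : seq X := flatten (map leaves ts).
Definition fnodes ts : nat := sumn (map nodes ts).

Lemma fleaves_cat ts1 ts2 : fleaves (ts1 ++ ts2) = fleaves ts1 ++ fleaves ts2.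
Proof. by rewrite /fleaves map_cat flatten_cat. Qed.

Lemma fnodes_cat ts1 ts2 : fnodes (ts1 ++ ts2) = (fnodes ts1 + fnodes ts2)%N.
Proof. by rewrite /fnodes map_cat sumn_cat. Qed.

End Trees.

Section TreeMap.
Variables (X Y : Type) (f : X -> Y).
Implicit Types (t : tree X) (ts : seq (tree X)).

Fixpoint tmap t : tree Y :=
  match t with
  | Leaf x => Leaf (f x)
  | Node t1 t2 => Node (tmap t1) (tmap t2)
  end.

Lemma leaves_tmap t : leaves (tmap t) = map f (leaves t).
Proof. by elim: t => //= t1 -> t2 ->; rewrite map_cat. Qed.

Lemma nodes_tmap t : nodes (tmap t) = nodes t.
Proof. by elim: t => //= t1 -> t2 ->. Qed.

Lemma fleaves_tmap ts :
  fleaves (map tmap ts) = map f (fleaves ts).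
Proof.
rewrite /fleaves map_flatten -!map_comp; congr flatten.
by apply: eq_map => t /=; rewrite leaves_tmap.
Qed.

Lemma fnodes_tmap ts :
  fnodes (map tmap ts) = fnodes ts.
Proof.
rewrite /fnodes -map_comp; congr sumn.
by apply: eq_map => t /=; rewrite nodes_tmap.
Qed.

End TreeMap.

Section TreeValue.
Variables (X : Type) (V : pzRingType) (phi : X -> V).

Fixpoint tval (t : tree X) : V :=
  match t with
  | Leaf x => phi x
  | Node t1 t2 => tval t1 * tval t2 - tval t2 * tval t1
  end.

Definition fval (ts : seq (tree X)) : V := \prod_(t <- ts) tval t.

Lemma fval_cat ts1 ts2 : fval (ts1 ++ ts2) = fval ts1 * fval ts2.
Proof. exact: big_cat. Qed.

Lemma fval_cons t ts : fval (t :: ts) = tval t * fval ts.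
Proof. exact: big_cons. Qed.

Lemma fval1 t : fval [:: t] = tval t.
Proof. exact: big_seq1. Qed.

End TreeValue.

Lemma tval_tmap (X Y : Type) (V : pzRingType) (phi : Y -> V) (f : X -> Y) t :
  tval phi (tmap f t) = tval (phi \o f) t.
Proof. by elim: t => //= t1 -> t2 ->. Qed.

Lemma eq_tval (X : Type) (V : pzRingType) (phi psi : X -> V) t :
  phi =1 psi -> tval phi t = tval psi t.
Proof. by move=> e; elim: t => //= t1 -> t2 ->. Qed.

Lemma fval_tmap (X Y : Type) (V : pzRingType) (phi : Y -> V) (f : X -> Y) ts :
  fval phi (map (tmap f) ts) = fval (phi \o f) ts.
Proof. by rewrite /fval big_map; apply: eq_bigr => t _; apply: tval_tmap. Qed.

(** * Expansion of commutators into signed words *)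

Section Expansion.
Variable X : eqType.
Implicit Types (s : seq (bool * seq X)).

(** A list of pairs (sign, word) is a formal signed sum. The words are kept because the evaluation
    to diagrams will be additive but not multiplicative, and because each of them permutes the
    leaves of the forest it comes from. *)
Definition emul s1 s2 : seq (bool * seq X) :=
  [seq (p.1 (+) q.1, p.2 ++ q.2) | p <- s1, q <- s2].

Definition eopp s : seq (bool * seq X) := [seq (~~ p.1, p.2) | p <- s].

Fixpoint texp (t : tree X) : seq (bool * seq X) :=
  match t with
  | Leaf x => [:: (false, [:: x])]
  | Node t1 t2 => emul (texp t1) (texp t2) ++ eopp (emul (texp t2) (texp t1))
  end.

Definition fexp (ts : seq (tree X)) : seq (bool * seq X) :=
  foldr (fun t => emul (texp t)) [:: (false, [::])] ts.

Lemma mem_emul s1 s2 l1 l2 :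
    (forall p, p \in s1 -> perm_eq p.2 l1) ->
    (forall p, p \in s2 -> perm_eq p.2 l2) ->
  forall p, p \in emul s1 s2 -> perm_eq p.2 (l1 ++ l2).
Proof.
move=> h1 h2 p /allpairsP[[q1 q2] /= [q1s q2s ->]] /=.
by apply: perm_cat; [apply: h1 | apply: h2].
Qed.

Lemma mem_texp t p : p \in texp t -> perm_eq p.2 (leaves t).
Proof.
elim: t p => [x|t1 IH1 t2 IH2] p /=; first by rewrite inE => /eqP->.
rewrite mem_cat => /orP[|/mapP[q + ->] /=]; first exact: mem_emul.
by rewrite perm_sym perm_catC perm_sym; apply: mem_emul.
Qed.

Lemma mem_fexp ts p : p \in fexp ts -> perm_eq p.2 (fleaves ts).
Proof.
elim: ts p => [|t ts IH] p /=; first by rewrite inE => /eqP->.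
exact: mem_emul (@mem_texp t) IH _.
Qed.

Section Value.
Variables (V : pzRingType) (phi : X -> V).

Definition evalue s : V := \sum_(p <- s) (-1) ^+ p.1 * \prod_(x <- p.2) phi x.

Lemma evalueM s1 s2 : evalue (emul s1 s2) = evalue s1 * evalue s2.
Proof.
rewrite /evalue big_allpairs_dep mulr_suml; apply: eq_bigr => p _.
rewrite mulr_sumr; apply: eq_bigr => q _ /=.
rewrite big_cat /= signr_addb -!mulrA; congr (_ * _); rewrite !mulrA.
by rewrite [X in _ = X * _]commr_sign.
Qed.

Lemma evalueN s : evalue (eopp s) = - evalue s.
Proof.
rewrite /evalue big_map -sumrN; apply: eq_bigr => p _ /=.
by rewrite signrN mulNr.
Qed.

Lemma tvalE t : tval phi t = evalue (texp t).
Proof.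
elim: t => [x|t1 IH1 t2 IH2] /=; first by rewrite /evalue !big_seq1 mul1r.
by rewrite IH1 IH2 -evalueM -[in X in _ - X]evalueM -evalueN /evalue big_cat.
Qed.

Lemma fvalE ts : fval phi ts = evalue (fexp ts).
Proof.
elim: ts => [|t ts IH] /=; first by rewrite /evalue /fval big_seq1 !big_nil mul1r.
by rewrite fval_cons evalueM IH tvalE.
Qed.

End Value.
End Expansion.

(** * Extraction of an innermost commutator *)

Section Cherry.
Variable X : eqType.

(* [None] marks the place of an innermost commutator of the letters [a], [b]. *)
Definition plug (V : pzRingType) (phi : X -> V) (a b : X) (o : option X) : V :=
  if o is Some x then phi x else phi a * phi b - phi b * phi a.

Lemma prod_plug (V : pzRingType) (phi : X -> V) a b (u v : seq X) :
  \prod_(o <- map Some u ++ None :: map Some v) plug phi a b o =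
  \prod_(x <- u ++ [:: a, b & v]) phi x - \prod_(x <- u ++ [:: b, a & v]) phi x.
Proof. by rewrite !big_cat !big_cons !big_map /= mulrBl mulrBr !mulrA. Qed.

(** Descending into a child that still has nodes ends at a node whose children are two leaves [a]
    and [b]; it is collapsed to the leaf [None]. The other letters, listed by [l], are untouched. *)
Lemma tree_cherry (t : tree X) : (0 < nodes t)%N ->
  exists (a b : X) (t' : tree (option X)) (l : seq X),
    [/\ forall (V : pzRingType) (phi : X -> V), tval phi t = tval (plug phi a b) t',
        nodes t = (nodes t').+1,
        perm_eq (leaves t') (None :: map Some l)
      & perm_eq (leaves t) [:: a, b & l]].
Proof.
have some (V : pzRingType) (phi : X -> V) a b u :
    tval (plug phi a b) (tmap Some u) = tval phi u.
  by rewrite tval_tmap; apply: eq_tval.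
elim: t => //= t1 IH1 t2 IH2 _.
have [n1|/IH1[a [b [t' [l [tv nd pt pl]]]]]] := posnP (nodes t1); last first.
  exists a, b, (Node t' (tmap Some t2)), (l ++ leaves t2); split => /=.
  - by move=> V phi; rewrite some tv.
  - by rewrite nd nodes_tmap.
  - by rewrite leaves_tmap map_cat -cat_cons perm_cat2r.
  - by rewrite -!cat_cons perm_cat2r.
have [n2|/IH2[a [b [t' [l [tv nd pt pl]]]]]] := posnP (nodes t2); last first.
  exists a, b, (Node (tmap Some t1) t'), (leaves t1 ++ l); split => /=.
  - by move=> V phi; rewrite some tv.
  - by rewrite nd nodes_tmap addnS.
  - rewrite leaves_tmap map_cat perm_sym -cat_cons -cat1s -catA perm_catCA /=.
    by rewrite perm_cat2l perm_sym.
  - rewrite perm_sym -[[:: a, b & _]]/([:: a; b] ++ _) perm_catCA perm_cat2l.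
    by rewrite perm_sym.
case: t1 n1 {IH1} => // a _; case: t2 n2 {IH2} => // b _.
by exists a, b, (Leaf None), [::].
Qed.

Lemma forest_cherry (ts : seq (tree X)) : (0 < fnodes ts)%N ->
  exists (a b : X) (ts' : seq (tree (option X))) (l : seq X),
    [/\ forall (V : pzRingType) (phi : X -> V),
          fval phi ts = fval (plug phi a b) ts',
        fnodes ts = (fnodes ts').+1,
        perm_eq (fleaves ts') (None :: map Some l)
      & perm_eq (fleaves ts) [:: a, b & l]].
Proof.
elim: ts => // t ts IH; rewrite /fnodes /= -/(fnodes ts).
have [n0|/tree_cherry[a [b [t' [l [tv nd pt pl]]]]]] := posnP (nodes t) => pos.
  rewrite n0 in pos; case: (IH pos) => a [b [ts' [l [tv nd pt pl]]]].
  exists a, b, (tmap Some t :: ts'), (leaves t ++ l); split.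
  - by move=> V phi; rewrite !fval_cons tval_tmap tv.
  - by rewrite n0 nd /= nodes_tmap n0.
  - rewrite /fleaves /= -/(fleaves _) leaves_tmap map_cat perm_sym.
    by rewrite -cat_cons -cat1s -catA perm_catCA /= perm_cat2l perm_sym.
  - rewrite /fleaves /= -/(fleaves _).
    rewrite perm_sym -[[:: a, b & _]]/([:: a; b] ++ _) perm_catCA perm_cat2l.
    by rewrite perm_sym.
exists a, b, (t' :: map (tmap Some) ts), (l ++ fleaves ts); split.
- move=> V phi; rewrite !fval_cons tv fval_tmap; congr (_ * _).
- by rewrite nd /= -/(fnodes _) fnodes_tmap.
- by rewrite {1}/fleaves /= -/(fleaves _) fleaves_tmap map_cat -cat_cons perm_cat2r.
- by rewrite {1}/fleaves /= -/(fleaves _) -!cat_cons perm_cat2r.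
Qed.

End Cherry.

(** * The filtration by number of brackets *)

Section CommutatorFiltration.
Variables (X : eqType) (T : eqType) (key : X -> T).
Variables (V : pzRingType) (phi : X -> V).
Implicit Types (ts us : seq (tree X)) (p q : nat) (x y z : V).

(* Words repeating a half-edge never evaluate to a diagram, so they may be put
   in every step of the filtration. *)
Definition deep p ts := (p <= fnodes ts)%N || ~~ uniq (map key (fleaves ts)).

Definition cfil p : V -> Prop :=
  zspan (fun x => exists2 ts, deep p ts & x = fval phi ts).

Lemma deep_cat p q ts us : deep p ts -> deep q us -> deep (p + q) (ts ++ us).
Proof.
rewrite /deep fleaves_cat fnodes_cat map_cat cat_uniq.
case/orP=> [h1|/negbTE->]; last by rewrite orbT.
case/orP=> [h2|/negbTE->]; last by rewrite !andbF orbT.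
by rewrite leq_add.
Qed.

Lemma cfil_fval p ts : deep p ts -> cfil p (fval phi ts).
Proof. by move=> h; apply: zspan_sub; exists ts. Qed.

Lemma cfilM p q x y : cfil p x -> cfil q y -> cfil (p + q) (x * y).
Proof.
apply: zspan_mul => _ _ [ts ht ->] [us hu ->].
by rewrite -fval_cat; apply/cfil_fval/deep_cat.
Qed.

(** The Leibniz rule in each argument, [t x, y] = t [x, y] + [t, y] x and [t, u y] = [t, u] y + u
    [t, y], reduces the bracket of two products to brackets [t, u] of single factors. Each of these
    is a tree with one additional node. *)
Lemma forest_bracket ts us :
  zspan (fun x => exists vs, [/\ x = fval phi vs,
      fnodes vs = (fnodes ts + fnodes us).+1
    & perm_eq (fleaves vs) (fleaves ts ++ fleaves us)])
  (fval phi ts * fval phi us - fval phi us * fval phi ts).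
Proof.
elim: ts => [|t ts IH].
  by rewrite /fval big_nil mul1r mulr1 subrr; apply: zspan0.
have -> : fval phi (t :: ts) * fval phi us - fval phi us * fval phi (t :: ts) =
    tval phi t * (fval phi ts * fval phi us - fval phi us * fval phi ts) +
    (tval phi t * fval phi us - fval phi us * tval phi t) * fval phi ts.
  by rewrite fval_cons mulrBr mulrBl !mulrA addrA subrK.
apply: zspanD.
  move: IH; elim=> [|e x z [vs [-> nd pl]] _ IH].
    by rewrite mulr0; apply: zspan0.
  rewrite mulrDr mulrA commr_sign -mulrA.
  apply: zspanDZ => //; exists (t :: vs); split; first by rewrite fval_cons.
    by rewrite /fnodes /= -/(fnodes _) nd -/(fnodes ts) addnS addnA.
  by rewrite /fleaves /= -/(fleaves _) -catA perm_cat2l.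
elim: us {IH} => [|u us IH].
  by rewrite /fval big_nil mul1r mulr1 subrr mul0r; apply: zspan0.
have -> : (tval phi t * fval phi (u :: us) - fval phi (u :: us) * tval phi t)
      * fval phi ts =
    tval phi (Node t u) * fval phi us * fval phi ts +
    tval phi u * ((tval phi t * fval phi us - fval phi us * tval phi t)
                  * fval phi ts).
  by rewrite fval_cons /= !mulrBl !mulrBr !mulrA addrA subrK.
apply: zspanD.
  apply: zspan_sub; exists (Node t u :: us ++ ts); split.
  - by rewrite fval_cons fval_cat mulrA.
  - rewrite /fnodes /= map_cat sumn_cat -!/(fnodes _).
    by rewrite addSn -!addnA; congr (_ + _).+1; rewrite addnA [RHS]addnC.
  rewrite /fleaves /= map_cat flatten_cat -!/(fleaves _) -!catA perm_cat2l.
  by rewrite (catA (leaves u)) perm_catC.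
move: IH; elim=> [|e x z [vs [-> nd pl]] _ IH].
  by rewrite mulr0; apply: zspan0.
rewrite mulrDr mulrA commr_sign -mulrA.
apply: zspanDZ => //; exists (u :: vs); split; first by rewrite fval_cons.
  rewrite /fnodes /= -/(fnodes vs) nd /fnodes /= -!/(fnodes _).
  by rewrite addnS addnCA.
rewrite /fleaves /= -/(fleaves vs) perm_sym -!/(fleaves _).
by rewrite perm_catCA perm_cat2l perm_sym.
Qed.

(** Bilinearity reduces to forests. A repeated key survives there because the new forests have the
    same leaves up to permutation. *)
Lemma cfil_bracket p q x y : cfil p x -> cfil q y ->
  cfil (p + q).+1 (x * y - y * x).
Proof.
move=> sx sy; elim: sx => [|e _ z [ts ht ->] _ IH].
  by rewrite mul0r mulr0 subrr; apply: zspan0.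
have -> : ((-1) ^+ e * fval phi ts + z) * y - y * ((-1) ^+ e * fval phi ts + z) =
    (-1) ^+ e * (fval phi ts * y - y * fval phi ts) + (z * y - y * z).
  rewrite mulrDl mulrDr opprD addrACA; congr (_ + _).
  by rewrite mulrBr !mulrA [y * _]commr_sign.
apply/zspanD/IH/zspan_sign => {IH}.
elim: sy => [|e' _ w [us hu ->] _ IH].
  by rewrite mul0r mulr0 subrr; apply: zspan0.
have -> : fval phi ts * ((-1) ^+ e' * fval phi us + w) -
    ((-1) ^+ e' * fval phi us + w) * fval phi ts =
    (-1) ^+ e' * (fval phi ts * fval phi us - fval phi us * fval phi ts)
    + (fval phi ts * w - w * fval phi ts).
  rewrite mulrDl mulrDr opprD addrACA; congr (_ + _).
  by rewrite mulrBr !mulrA [fval phi ts * _]commr_sign.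
apply/zspanD/IH/zspan_sign; apply: zspan_trans (forest_bracket ts us).
move=> _ [vs [-> nd pl]]; apply: cfil_fval; rewrite /deep nd.
rewrite (perm_uniq (perm_map key pl)) map_cat cat_uniq ltnS.
case/orP: ht => [h1|/negbTE->]; last by rewrite orbT.
case/orP: hu => [h2|/negbTE->]; last by rewrite !andbF orbT.
by rewrite leq_add.
Qed.

(** The intersection of the filtration plays the role of zero: group identities will hold only
    modulo it. *)
Definition cnull x := forall p, cfil p x.

Lemma cnullD x y : cnull x -> cnull y -> cnull (x + y).
Proof. by move=> hx hy p; exact: zspanD (hx p) (hy p). Qed.

Lemma cnullN x : cnull x -> cnull (- x).
Proof. by move=> hx p; exact: zspanN (hx p). Qed.

Lemma cnullMl x y : cfil 0 x -> cnull y -> cnull (x * y).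
Proof. by move=> hx hy p; exact: cfilM hx (hy p). Qed.

Lemma cnullMr x y : cnull x -> cfil 0 y -> cnull (x * y).
Proof. by move=> hx hy p; rewrite -[p]addn0; exact: cfilM (hx p) hy. Qed.

Lemma cfil0_1 : cfil 0 1.
Proof. by have := @cfil_fval 0 [::] isT; rewrite /fval big_nil. Qed.

Lemma cfil0_gen a : cfil 0 (phi a).
Proof. by have := @cfil_fval 0 [:: Leaf a] isT; rewrite fval1. Qed.

(** Letters will be pairs (arc, half-edge) with the half-edge as key, so a half-edge placed on two
    different arcs also counts as a repetition. *)
Lemma cnull_repeat a b : key a = key b -> cnull (phi a * phi b).
Proof.
move=> e p; have := @cfil_fval p [:: Leaf a; Leaf b].
rewrite fval_cons fval1; apply.
by rewrite /deep /= e inE eqxx orbT.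
Qed.

End CommutatorFiltration.

(** * Lower central series and commutator filtration *)

Section Holonomy.
Variables (X : eqType) (T : eqType) (key : X -> T).
Variables (V : pzRingType) (phi : X -> V).
Local Notation cfil := (cfil key phi).
Local Notation cnull := (cnull key phi).

Lemma cfil0_prod (I : Type) (s : seq I) (F : I -> V) :
  (forall i, cfil 0 (F i)) -> cfil 0 (\prod_(i <- s) F i).
Proof.
move=> F0; elim: s => [|i s IH]; first by rewrite big_nil; apply: cfil0_1.
by rewrite big_cons; apply: (@cfilM _ _ _ _ _ 0 0).
Qed.

(** Telescoping: the factors are replaced one at a time. *)
Lemma cfil_prodB (I : Type) (s : seq I) (F G : I -> V) p :
    (forall i, cfil 0 (F i)) -> (forall i, cfil 0 (G i)) ->
    (forall i, cfil p (F i - G i)) ->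
  cfil p (\prod_(i <- s) F i - \prod_(i <- s) G i).
Proof.
move=> F0 G0 FG; elim: s => [|i s IH].
  by rewrite !big_nil subrr; apply: zspan0.
rewrite !big_cons -[_ * _](subrK (G i * \prod_(j <- s) F j)) -addrA.
rewrite -mulrBl -mulrBr; apply: zspanD.
  by rewrite -[p]addn0; apply: cfilM => //; apply: cfil0_prod.
exact: (@cfilM _ _ _ _ _ 0 p).
Qed.

(** The two products cancel from the inside out, since (1 + x)(1 - x) = 1 - x^2 and x^2 repeats a
    key. *)
Lemma cnull_inverse (s : seq X) (e : bool) :
  cnull (\prod_(x <- s) (1 + (-1) ^+ e * phi x) *
         \prod_(x <- rev s) (1 + (-1) ^+ (~~ e) * phi x) - 1).
Proof.
have c0 (b : bool) x : cfil 0 (1 + (-1) ^+ b * phi x).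
  by apply: zspanD; [apply: cfil0_1 | apply/zspan_sign/cfil0_gen].
elim: s => [|x s IH]; first by rewrite !big_nil mulr1 subrr => p; apply: zspan0.
rewrite big_cons rev_cons -cats1 big_cat big_seq1 /= !mulrA.
set A := 1 + _ * phi x; set B := \prod_(y <- s) (1 + (-1) ^+ e * phi y).
set C := \prod_(y <- rev s) (1 + (-1) ^+ (~~ e) * phi y).
set D := 1 + _ * phi x.
have -> : A * B * C * D - 1 = A * (B * C - 1) * D + (A * D - 1).
  by rewrite mulrBr mulr1 mulrBl !mulrA addrA subrK.
apply: cnullD; first exact/cnullMr/c0/cnullMl/IH/c0.
have -> : A * D - 1 = - (phi x * phi x).
  rewrite /A /D signrN mulNr mulrBr mulr1 mulrDl mul1r opprD addrA addrK.
  rewrite addrAC subrr add0r mulrA -(mulrA _ (phi x)) commr_sign mulrA.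
  by rewrite -signr_addb addbb mul1r.
exact/cnullN/cnull_repeat.
Qed.

Variables (m : nat) (rho : letter m -> V).
Hypothesis rho0 : forall a, cfil 0 (rho a).
Hypothesis rhoK : forall a, cnull (rho a * rho (linv a) - 1).

(* The product is reversed because arcs are concatenated from the rightmost
   letter of a word on. *)
Definition holonomy (w : seq (letter m)) : V := \prod_(a <- rev w) rho a.

Lemma holonomy_cons a w : holonomy (a :: w) = holonomy w * rho a.
Proof. by rewrite /holonomy rev_cons -cats1 big_cat big_seq1. Qed.

Lemma cfil0_holonomy w : cfil 0 (holonomy w).
Proof. exact: cfil0_prod. Qed.

(** Only a cancellation matters: it deletes a factor [rho (linv a) * rho a], which is 1 modulo
    [cnull]. *)
Lemma holonomy_lmul a w :
  cnull (holonomy (lmul a w) - holonomy w * rho a).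
Proof.
case: w => [|b w] /=.
  by rewrite holonomy_cons subrr => p; apply: zspan0.
case: eqP => [->|_]; last by rewrite holonomy_cons subrr => p; apply: zspan0.
rewrite holonomy_cons -mulrA -opprB -{2}[holonomy w]mulr1 -mulrBr.
apply/cnullN/cnullMl; first exact: cfil0_holonomy.
by rewrite -{2}(linvK a); apply: rhoK.
Qed.

Lemma holonomyM (u v : freegroup m) :
  cnull (holonomy (u * v)%g - holonomy v * holonomy u).
Proof.
rewrite -[fgword (u * v)%g]/(wmul u v).
elim: (fgword u) => [|a w IH] /=.
  by rewrite /(holonomy [::]) big_nil mulr1 subrr => p; apply: zspan0.
have -> : holonomy (lmul a (wmul w v)) - holonomy v * holonomy (a :: w) =
    (holonomy (lmul a (wmul w v)) - holonomy (wmul w v) * rho a) +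
    (holonomy (wmul w v) - holonomy v * holonomy w) * rho a.
  by rewrite mulrBl addrA subrK holonomy_cons mulrA.
by apply: cnullD; [apply: holonomy_lmul | apply: cnullMr].
Qed.

Lemma holonomy1 : holonomy (1%g : freegroup m) = 1.
Proof. exact: big_nil. Qed.

Lemma holonomyV (u : freegroup m) :
  cnull (holonomy u * holonomy (u^-1)%g - 1).
Proof.
rewrite -opprB; apply: cnullN; rewrite -[X in X - _]holonomy1 -(mulVg u).
exact: holonomyM.
Qed.

(** Each passage from one term of the lower central series to the next costs one commutator, hence
    one more bracket in the ring. *)
Lemma holonomy_lower_central p (u : freegroup m) :
  lower_central p.+1 u -> cfil p (holonomy u - 1).
Proof.
elim: p u => [|p IH] u.
  by move=> _; apply: zspanB; [apply: cfil0_holonomy | apply: cfil0_1].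
rewrite -[lower_central p.+2]/(subgroup_gen
  (commutators (lower_central p.+1) classical_sets.setT)).
elim=> {u} [_ [x [y [hx _ ->]]]||x y _ hx _ hy|x _ hx].
- have hxy : cfil p.+1 (holonomy (x * y)%g - holonomy (y * x)%g).
    have -> : holonomy (x * y)%g - holonomy (y * x)%g =
        (holonomy (x * y)%g - holonomy y * holonomy x) +
        (holonomy y * holonomy x - holonomy x * holonomy y) -
        (holonomy (y * x)%g - holonomy x * holonomy y).
      by rewrite addrA subrK opprB addrA subrK.
    apply: zspanB; last exact: holonomyM.
    apply: zspanD; first exact: holonomyM.
    (* Subtracting 1 from both factors does not change their commutator, but puts them in steps [0]
       and [p], so that the commutator lies in step [p.+1]. *)
    have -> : holonomy y * holonomy x - holonomy x * holonomy y =
        (holonomy y - 1) * (holonomy x - 1) - (holonomy x - 1) * (holonomy y - 1).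
      have E a b : (a - 1) * (b - 1) = a * b - (a + b - 1) :> V.
        by rewrite mulrBl mulrBr mul1r mulr1 -addrA -opprD addrA.
      rewrite !E [holonomy x + _]addrC; move: (holonomy y + _ - 1) => w.
      by rewrite opprB addrA subrK.
    rewrite -[p.+1]/(0 + p).+1; apply: cfil_bracket; last exact: IH.
    by apply: zspanB; [apply: cfil0_holonomy | apply: cfil0_1].
  (* Since x y = P c, the holonomy of [x * y] is that of [c] times that of [P] modulo [cnull]; this
     is solved for [holonomy c], with [holonomy (P^-1)] as inverse of [holonomy P]. *)
  set c := [~ x, y]%g; set P := (y * x)%g.
  have -> : holonomy c - 1 =
      - (holonomy c * (holonomy P * holonomy (P^-1)%g - 1)) -
      (holonomy (P * c)%g - holonomy c * holonomy P) * holonomy (P^-1)%g +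
      (holonomy (x * y)%g - holonomy P) * holonomy (P^-1)%g +
      (holonomy P * holonomy (P^-1)%g - 1).
    rewrite {3}/P {3}/c -commgC.
    rewrite mulrBr mulr1 !mulrBl -mulrA !opprB addrA !addrA.
    by rewrite !subrK.
  have cP := cfil0_holonomy (P^-1)%g.
  apply: zspanD; last exact: holonomyV.
  apply: zspanD; last by rewrite -[p.+1]addn0; apply: cfilM.
  apply: zspanB.
    apply: zspanN; apply: cnullMl; first exact: cfil0_holonomy.
    exact: holonomyV.
  by apply: cnullMr => //; apply: holonomyM.
- by rewrite holonomy1 subrr; apply: zspan0.
- have -> : holonomy (x * y)%g - 1 =
      (holonomy (x * y)%g - holonomy y * holonomy x) +
      ((holonomy y - 1) * holonomy x + (holonomy x - 1)).
    by rewrite mulrBl mul1r !addrA !subrK.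
  apply: zspanD; first exact: holonomyM.
  apply: zspanD => //; rewrite -[p.+1]addn0.
  by apply: cfilM => //; apply: cfil0_holonomy.
have -> : holonomy (x^-1)%g - 1 =
    - ((holonomy x - 1) * holonomy (x^-1)%g) +
    (holonomy x * holonomy (x^-1)%g - 1).
  by rewrite mulrBl mul1r opprB addrA subrK.
apply: zspanD; last exact: holonomyV.
apply: zspanN; rewrite -[p.+1]addn0.
by apply: cfilM => //; apply: cfil0_holonomy.
Qed.

Lemma holonomy_mulB p (u v : freegroup m) :
  lower_central p.+1 u -> cfil p (holonomy (u * v)%g - holonomy v).
Proof.
move=> hu; have -> : holonomy (u * v)%g - holonomy v =
    (holonomy (u * v)%g - holonomy v * holonomy u) +
    holonomy v * (holonomy u - 1).
  by rewrite mulrBr mulr1 addrA subrK.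
apply: zspanD; first exact: holonomyM.
apply: (@cfilM _ _ _ _ _ 0 p); first exact: cfil0_holonomy.
exact: holonomy_lower_central.
Qed.

End Holonomy.

(** * Joining two legs at a trivalent vertex *)

Section CubicRotation.
Variables (N : nat) (r : {perm 'I_N}).
Hypothesis r3 : forall h, r (r (r h)) = h.

Lemma porbit_rot3 h : porbit r h = [set h; r h; r (r h)].
Proof.
apply/setP=> x; rewrite !inE; apply/porbitP/idP => [[i ->]|].
  elim: i => [|i]; first by rewrite perm1 eqxx.
  rewrite expgSr permM => /orP[/orP[]|] /eqP->; rewrite ?r3 eqxx ?orbT //.
case/orP=> [/orP[]|] /eqP->; [exists 0%N | exists 1%N | exists 2%N].
- by rewrite perm1.
- by [].
- by rewrite permM.
Qed.

Lemma card_porbit_rot3 h : #|porbit r h| = if r h == h then 1%N else 3%N.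
Proof.
rewrite porbit_rot3; case: (eqVneq (r h) h) => [e|ne].
  by rewrite !e !setUid cards1.
rewrite -setUA !cardsU1 cards1 !inE (inj_eq perm_inj) ![h == r h]eq_sym.
rewrite (negbTE ne) /=.
case: eqP => // e; case/eqP: ne.
by rewrite -[RHS](r3 h) -e.
Qed.

Lemma card_porbits_in (S : {set 'I_N}) k :
    (forall h, (r h \in S) = (h \in S)) ->
    (forall h, h \in S -> #|porbit r h| = k) ->
  #|S| = (#|[set porbit r h | h in S]| * k)%N.
Proof.
move=> rS ck; apply: card_uniform_partition.
  by move=> _ /imsetP[h hS ->]; apply: ck.
rewrite porbitE; apply: orbit_partition.
by rewrite cycle_subG !inE /=; apply/subsetP=> h; rewrite !inE /= apermE rS.
Qed.

Local Notation P3 := [set v in porbits r | #|v| == 3%N].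

(** Orbits of a rotation with cube 1 have one or three elements, so vertices can be counted through
    fixed and moved half-edges, which are easier to follow when a vertex is added. *)
Lemma rot3_trivalent : #|[set h | r h != h]| = (#|P3| * 3)%N.
Proof.
have -> : P3 = [set porbit r h | h in [set h | r h != h]].
  apply/setP=> v; rewrite inE; apply/andP/imsetP.
    case=> /imsetP[h _ ->]; rewrite card_porbit_rot3 => c.
    by exists h => //; rewrite inE; apply: contraL c => ->.
  case=> h; rewrite inE => /negbTE ne ->; rewrite card_porbit_rot3 ne.
  by rewrite imset_f.
apply: card_porbits_in => h; rewrite !inE; first by rewrite (inj_eq perm_inj).
by rewrite card_porbit_rot3 => /negbTE->.
Qed.

Lemma rot3_vertices : #|porbits r| = (#|P3| + #|[set h | r h == h]|)%N.
Proof.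
rewrite -(cardsID [set v : {set _} | #|v| == 3%N] (porbits r)); congr (_ + _)%N.
  by apply: eq_card => v; rewrite !inE.
have -> : (porbits r :\: [set v : {set _} | #|v| == 3%N]) =
    [set porbit r h | h in [set h | r h == h]].
  apply/setP=> v; rewrite !inE; apply/andP/imsetP.
    case=> c /imsetP[h _ e]; exists h => //.
    rewrite inE; apply: contraR c => /negbTE ne.
    by rewrite e card_porbit_rot3 ne.
  by case=> h; rewrite inE => e ->; rewrite card_porbit_rot3 e imset_f.
apply/esym; rewrite -[RHS]muln1; apply: card_porbits_in => h; rewrite !inE.
  by rewrite (inj_eq perm_inj).
by rewrite card_porbit_rot3 => ->.
Qed.

End CubicRotation.

(** * Diagrams whose legs are given by a single word *)

Section WordDiagram.
Variables (n : nat).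

(* A word in pairs (arc, half-edge) places half-edges on all arcs at once.    *)
Definition wdiag N (r f : {perm 'I_N}) (w : seq ('I_n * 'I_N)) : prediagram n :=
  Prediagram r f [ffun j => [seq x.2 | x <- w & x.1 == j]].

Lemma count_arcs N (w : seq ('I_n * 'I_N)) h :
  (\sum_j count_mem h [seq x.2 | x <- w & x.1 == j])%N =
  count_mem h (map snd w).
Proof.
elim: w => [|[i g] w IH] /=; first by rewrite big1.
rewrite -IH (bigD1 i) //= [in RHS](bigD1 i) //= eqxx /= -addnA.
by congr (_ + (_ + _))%N; apply: eq_bigr => j; rewrite eq_sym => /negbTE->.
Qed.

Lemma wdiag_jacobiP N (r f : {perm 'I_N}) w d :
  reflect [/\ forall h, r (r (r h)) = h,
      forall h, f (f h) = h /\ f h != h,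
      forall h, count_mem h (map snd w) = (r h == h),
      forall h, exists2 l, r l = l & connect (@adj n (wdiag r f w)) h l
    & #|porbits r| = d.*2]
  (is_jacobi (wdiag r f w) d).
Proof.
have sE h : (\sum_i count_mem h (legs (wdiag r f w) i))%N = count_mem h (map snd w).
  by rewrite -count_arcs; apply: eq_bigr => j _; rewrite ffunE.
apply: (iffP and5P) => [[/forallP h1 /forallP h2 /forallP h3 /forallP h4 /eqP h5]|].
  split=> // h.
  - have := iter_porbit r h; have := h1 h; rewrite !inE /=.
    by move=> /orP[] /eqP c; rewrite c //= => e; rewrite !e.
  - by case/andP: (h2 h) => /eqP.
  - by rewrite -sE; apply/eqP/h3.
  - by case/existsP: (h4 h) => l /andP[/eqP ? ?]; exists l.
case=> h1 h2 h3 h4 h5; split; try apply/forallP=> h.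
- by rewrite card_porbit_rot3 //; case: ifP.
- by case: (h2 h) => -> ->; rewrite eqxx.
- by rewrite sE h3.
- by case: (h4 h) => l e c; apply/existsP; exists l; rewrite /= e eqxx.
- exact/eqP.
Qed.

(** The Jacobi conditions see which half-edges occur, but neither their order nor their arcs. They
    can thus be tested on the leaves of a forest instead of on every word of its expansion. *)
Lemma wdiag_perm N (r f : {perm 'I_N}) w w' d :
    perm_eq (map snd w) (map snd w') ->
  is_jacobi (wdiag r f w) d = is_jacobi (wdiag r f w') d.
Proof.
move=> /seq.permP e; apply/wdiag_jacobiP/wdiag_jacobiP => -[h1 h2 h3 h4 h5].
  by split=> // h; rewrite -h3 -e.
by split=> // h; rewrite -h3 e.
Qed.

End WordDiagram.

(** * Grafting a trivalent vertex onto two univalent ones *)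

Section Fuse.
Variables (N : nat) (r f : {perm 'I_N}) (a b : 'I_N).
Hypotheses (ab : a != b) (ra : r a = a) (rb : r b = b).

Let H := option (option 'I_N).
(* The univalent vertices [a] and [b] are joined to a new trivalent vertex, with
   cyclic order (stem, b, a) as in [resolution]; the new edge runs from [fstem]
   to the new univalent vertex [ffoot]. *)
Definition fuse_size := #|{: option (option 'I_N)}|.
Local Notation N' := fuse_size.

Definition fnew (h : 'I_N) : 'I_N' := enum_rank (Some (Some h)).
Definition fstem : 'I_N' := enum_rank None.
Definition ffoot : 'I_N' := enum_rank (Some None).

Let R (o : H) : H :=
  match o with
  | None => Some (Some b)
  | Some None => Some None
  | Some (Some h) =>
      if h == a then None else Some (Some (if h == b then a else r h))
  end.

Let F (o : H) : H :=
  match o with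
  | None => Some None
  | Some None => None
  | Some (Some h) => Some (Some (f h))
  end.

Let R_inj : injective R.
Proof.
pose Q (o : H) : H :=
  match o with
  | None => Some (Some a)
  | Some None => Some None
  | Some (Some h) =>
      if h == b then None else Some (Some (if h == a then b else (r^-1)%g h))
  end.
apply: (can_inj (g := Q)) => -[[h|]|] //=; last by rewrite eqxx.
case: (eqVneq h a) => [->|ha] //=; case: (eqVneq h b) => [->|hb].
  by rewrite (negbTE ab) eqxx.
(* As [a] and [b] are fixed by [r], no other half-edge is sent to them. *)
rewrite -{1}rb -{1}ra !(inj_eq perm_inj) (negbTE ha) (negbTE hb).
by rewrite permK.
Qed.

Let F_inj : injective F.
Proof. by move=> [[h|]|] [[g|]|] //= [/perm_inj->]. Qed.

Let conj (g : H -> H) (x : 'I_N') : 'I_N' := enum_rank (g (enum_val x)).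

Let conj_inj g : injective g -> injective (conj g).
Proof. by move=> gi x y /enum_rank_inj/gi/enum_val_inj. Qed.

Definition fuse_rot : {perm 'I_N'} := perm (conj_inj R_inj).
Definition fuse_flip : {perm 'I_N'} := perm (conj_inj F_inj).

Lemma fnew_inj : injective fnew.
Proof. by move=> h g /enum_rank_inj[]. Qed.

Lemma fuseP x : [\/ x = fstem, x = ffoot | exists h, x = fnew h].
Proof.
rewrite -(enum_valK x); case: (enum_val x) => [[h|]|].
- by apply: Or33; exists h.
- exact: Or32.
- exact: Or31.
Qed.

Lemma fstem_new h : (fstem == fnew h) = false.
Proof. by apply/eqP=> /enum_rank_inj. Qed.

Lemma ffoot_new h : (ffoot == fnew h) = false.
Proof. by apply/eqP=> /enum_rank_inj. Qed.

Lemma fstem_foot : (fstem == ffoot) = false.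
Proof. by apply/eqP=> /enum_rank_inj. Qed.

Lemma rot_stem : fuse_rot fstem = fnew b.
Proof. by rewrite permE /conj enum_rankK. Qed.

Lemma rot_foot : fuse_rot ffoot = ffoot.
Proof. by rewrite permE /conj enum_rankK. Qed.

Lemma rot_newb : fuse_rot (fnew b) = fnew a.
Proof. by rewrite permE /conj enum_rankK /= eq_sym (negbTE ab) eqxx. Qed.

Lemma rot_newa : fuse_rot (fnew a) = fstem.
Proof. by rewrite permE /conj enum_rankK /= eqxx. Qed.

Lemma rot_new h : h != a -> h != b -> fuse_rot (fnew h) = fnew (r h).
Proof.
by move=> /negbTE ha /negbTE hb; rewrite permE /conj enum_rankK /= ha hb.
Qed.

Lemma flip_stem : fuse_flip fstem = ffoot.
Proof. by rewrite permE /conj enum_rankK. Qed.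

Lemma flip_foot : fuse_flip ffoot = fstem.
Proof. by rewrite permE /conj enum_rankK. Qed.

Lemma flip_new h : fuse_flip (fnew h) = fnew (f h).
Proof. by rewrite permE /conj enum_rankK. Qed.

Lemma fuse_fixed h :
  (fuse_rot (fnew h) == fnew h) = [&& h != a, h != b & r h == h].
Proof.
case: (eqVneq h a) => [->|ha]; first by rewrite rot_newa fstem_new.
case: (eqVneq h b) => [->|hb]; first by rewrite rot_newb (inj_eq fnew_inj) (negbTE ab).
by rewrite rot_new // (inj_eq fnew_inj).
Qed.

(** The points [a] and [b] cease to be fixed, and the foot is a new fixed point. *)
Lemma card_fuse_fixed :
  #|[set h | r h == h]| = #|[set x | fuse_rot x == x]|.+1.
Proof.
have -> : [set x | fuse_rot x == x] =
    (ffoot |: [set fnew h | h in [set h | r h == h] :\ a :\ b]).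
  apply/setP=> x; rewrite !inE; case: (fuseP x) => [->|->|[h ->]].
  - rewrite rot_stem eq_sym fstem_new fstem_foot /=.
    by apply/esym/imsetP=> -[h _ /eqP]; rewrite fstem_new.
  - by rewrite rot_foot !eqxx.
  rewrite fuse_fixed [_ == ffoot]eq_sym ffoot_new mem_imset; last exact: fnew_inj.
  by rewrite !inE andbCA.
rewrite cardsU1 card_imset; last exact: fnew_inj.
have -> : ffoot \notin [set fnew h | h in [set h | r h == h] :\ a :\ b].
  by apply/imsetP=> -[h _ /eqP]; rewrite ffoot_new.
rewrite (cardsD1 a) (cardsD1 b (_ :\ a)) !inE ra rb !eqxx [b == a]eq_sym ab.
by rewrite !add1n.
Qed.

Lemma card_fuse_moved :
  #|[set x | fuse_rot x != x]| = (#|[set h | r h != h]| + 3)%N.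
Proof.
have cC n' (p : {perm 'I_n'}) :
    (#|[set x | p x == x]| + #|[set x | p x != x]|)%N = n'.
  rewrite -[RHS]card_ord -(cardsC [set x | p x == x]); congr (_ + _)%N.
  by apply: eq_card => x; rewrite !inE.
have e : fuse_size = N.+2 by rewrite /fuse_size !card_option card_ord.
have := etrans (cC _ fuse_rot) (etrans e (congr1 (addn 2) (esym (cC _ r)))).
rewrite card_fuse_fixed !addSn -!addnS => /eqP.
by rewrite add0n eqn_add2l => /eqP->; rewrite addn3.
Qed.

Lemma fuse_rot3 : (forall h, r (r (r h)) = h) ->
  forall x, fuse_rot (fuse_rot (fuse_rot x)) = x.
Proof.
move=> r3 x; case: (fuseP x) => [->|->|[h ->]].
- by rewrite rot_stem rot_newb rot_newa.
- by rewrite !rot_foot.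
case: (eqVneq h a) => [->|ha]; first by rewrite rot_newa rot_stem rot_newb.
case: (eqVneq h b) => [->|hb]; first by rewrite rot_newb rot_newa rot_stem.
have step g : g != a -> g != b -> (r g != a) && (r g != b).
  by move=> ga gb; rewrite -{1}ra -{1}rb !(inj_eq perm_inj) ga gb.
have /andP[ha1 hb1] := step _ ha hb; have /andP[ha2 hb2] := step _ ha1 hb1.
by rewrite !rot_new ?r3.
Qed.

(** There are two half-edges more in all and one fixed point fewer, hence three more moved ones;
    division by 3 gives one more vertex. *)
Lemma fuse_trivalent : (forall h, r (r (r h)) = h) ->
  #|[set v in porbits fuse_rot | #|v| == 3%N]| =
  #|[set v in porbits r | #|v| == 3%N]|.+1.
Proof.
move=> r3; apply/eqP; rewrite -(eqn_pmul2r (isT : 0 < 3)%N) -rot3_trivalent.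
  by rewrite card_fuse_moved rot3_trivalent // mulSn addnC.
exact: fuse_rot3.
Qed.

Variables (n d : nat).
Implicit Types (u v w : seq ('I_n * 'I_N)).

Definition wnew w : seq ('I_n * 'I_N') := [seq (x.1, fnew x.2) | x <- w].

(** Paths survive the fusion: a rotation step is altered only at [a] and [b], where the old one
    stood still. *)
Lemma fuse_connect w (x : seq ('I_n * 'I_N')) (h l : 'I_N) :
  connect (@adj n (wdiag r f w)) h l ->
  connect (@adj n (wdiag fuse_rot fuse_flip x)) (fnew h) (fnew l).
Proof.
case/connectP=> p; elim: p h => [|g p IH] h /=; first by move=> _ ->; apply: connect0.
case/andP=> hg /IH{}IH /IH; apply: connect_trans; case/orP: hg => /eqP->.
  case: (eqVneq h a) => [->|ha]; first by rewrite /= ra connect0.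
  case: (eqVneq h b) => [->|hb]; first by rewrite /= rb connect0.
  by apply: connect1; rewrite /adj /= rot_new // eqxx.
by apply: connect1; rewrite /adj /= flip_new eqxx orbT.
Qed.

(** The degree is kept because one univalent vertex is lost and one trivalent vertex gained. *)
Lemma fuse_jacobi u v i j k :
    is_jacobi (wdiag r f (u ++ (i, a) :: (j, b) :: v)) d ->
  is_jacobi (wdiag fuse_rot fuse_flip (wnew u ++ (k, ffoot) :: wnew v)) d.
Proof.
case/wdiag_jacobiP => h1 h2 h3 h4 h5; apply/wdiag_jacobiP; split.
- exact: fuse_rot3.
- move=> x; case: (fuseP x) => [->|->|[h ->]].
  + by rewrite flip_stem flip_foot eq_sym fstem_foot.
  + by rewrite flip_foot flip_stem fstem_foot.
  by rewrite !flip_new (inj_eq fnew_inj); case: (h2 h) => -> ->.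
- move=> x; rewrite map_cat count_cat /= /wnew -!map_comp.
  have cn (w : seq ('I_n * 'I_N)) h :
      count_mem (fnew h) [seq (snd \o (fun x => (x.1, fnew x.2))) y | y <- w] =
      count_mem h (map snd w).
    by rewrite !count_map; apply: eq_count => y /=; rewrite (inj_eq fnew_inj).
  have c0 (w : seq ('I_n * 'I_N)) y : (forall h, y == fnew h = false) ->
      count_mem y [seq (snd \o (fun x => (x.1, fnew x.2))) z | z <- w] = 0%N.
    move=> ny; rewrite count_map (eq_count (a2 := pred0)) ?count_pred0 // => z /=.
    by rewrite eq_sym ny.
  case: (fuseP x) => [->|->|[h ->]].
  + rewrite !c0; try exact: fstem_new.
    by rewrite rot_stem ![_ == fstem]eq_sym fstem_foot fstem_new.
  + rewrite !c0; try exact: ffoot_new.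
    by rewrite rot_foot !eqxx.
  rewrite !cn ffoot_new fuse_fixed.
  have := h3 h; rewrite map_cat count_cat /= [a == h]eq_sym [b == h]eq_sym.
  case: (eqVneq h a) => [->|ha].
    rewrite ra eqxx (negbTE ab) addnS => -[/eqP].
    by rewrite addn_eq0 add0n => /andP[/eqP-> /eqP->].
  case: (eqVneq h b) => [->|hb].
    rewrite rb eqxx !addnS => -[/eqP].
    by rewrite addn_eq0 add0n => /andP[/eqP-> /eqP->].
  by rewrite !add0n => ->.
(* An old path to a univalent vertex may end at [a] or [b], no longer univalent; from there it
   continues to the foot through [b], [a] and the stem. *)
- pose W := wdiag fuse_rot fuse_flip (wnew u ++ (k, ffoot) :: wnew v).
  pose live x := exists2 l, fuse_rot l = l & connect (@adj n W) x l.
  have step (x y : 'I_N') : @adj n W x y -> live y -> live x.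
    move=> xy [l rl yl]; exists l => //.
    exact: connect_trans (connect1 xy) yl.
  have lfoot : live ffoot by exists ffoot; [apply: rot_foot | apply: connect0].
  have lstem : live fstem.
    by apply: (step _ ffoot) => //; rewrite /adj /= flip_stem eqxx orbT.
  have la : live (fnew a).
    by apply: (step _ fstem) => //; rewrite /adj /= rot_newa eqxx.
  have lb : live (fnew b).
    by apply: (step _ (fnew a)) => //; rewrite /adj /= rot_newb eqxx.
  move=> x; case: (fuseP x) => [->|->|[h ->]] //.
  have [l rl /(fuse_connect (wnew u ++ (k, ffoot) :: wnew v)) hl] := h4 h.
  suff [m rm lm] : live (fnew l) by exists m => //; apply: connect_trans lm.
  case: (eqVneq l a) => [->//|na]; case: (eqVneq l b) => [->//|nb].
  by exists (fnew l); [rewrite rot_new // rl | apply: connect0].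
apply/eqP; have := rot3_vertices h1; have := rot3_vertices (fuse_rot3 h1).
rewrite fuse_trivalent // => ->; rewrite card_fuse_fixed addnS addSn => <-.
exact/eqP.
Qed.

End Fuse.

(** * Evaluation of noncommutative polynomials in legs *)

(** The alias carries concatenation as its monoid law, so that the monoid algebra on it is the free
    associative ring. *)
Definition word (A : choiceType) := seq A.

HB.instance Definition _ (A : choiceType) := Choice.on (word A).

Fact word_unit (A : choiceType) (u v : word A) :
  u ++ v = [::] -> u = [::] /\ v = [::].
Proof. by case: u. Qed.

HB.instance Definition _ (A : choiceType) := Choice_isMonomialDef.Build (word A)
  (@catA A) (@cat0s A) (@cats0 A) (@word_unit A).

Notation free_ring A := {malg int[word A]}.

Section FreeRing.
Variable A : choiceType.

Definition gen (a : A) : free_ring A := << ([:: a] : word A) >>.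

Lemma prod_gen (w : word A) : \prod_(a <- w) gen a = << w >>.
Proof.
elim: w => [|a w IH]; first by rewrite big_nil.
by rewrite big_cons IH /gen malgM_def fgmulUU mulr1.
Qed.

Variables (W : zmodType) (F : word A -> W).

(** The extension is additive only: the target is a space of diagrams, without product. *)
Definition free_ext (z : free_ring A) : W := \sum_(w <- msupp z) F w *~ z@_w.

Lemma free_extEw (S : {fset word A}) z : (msupp z `<=` S)%fset ->
  free_ext z = \sum_(w <- S) F w *~ z@_w.
Proof.
move=> sub; rewrite /free_ext (big_fset_incl _ sub) // => w _ nw.
by rewrite mcoeff_outdom // mulr0z.
Qed.

Lemma free_ext_is_zmod_morphism : zmod_morphism free_ext.
Proof.
move=> x y; pose S := (msupp x `|` msupp y)%fset.
rewrite (free_extEw (fsubsetUl _ _ : (msupp x `<=` S)%fset)).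
rewrite (free_extEw (fsubsetUr _ _ : (msupp y `<=` S)%fset)).
rewrite (free_extEw (msuppB_le _ _ : (msupp (x - y) `<=` S)%fset)) -sumrB.
by apply: eq_bigr => w _; rewrite mcoeffB mulrzBr.
Qed.

HB.instance Definition _ := GRing.isZmodMorphism.Build (free_ring A) W free_ext
  free_ext_is_zmod_morphism.

Lemma free_extU w : free_ext << w >> = F w.
Proof. by rewrite (free_extEw msuppU_le) big_seq_fset1 mcoeffUU. Qed.

End FreeRing.

(** Every word expanded from a forest with a collapsed cherry has exactly one hole, at which it is
    cut. *)
Lemma split_none (T : eqType) (s : seq (option T)) l :
    perm_eq s (None :: map Some l) ->
  exists u v, s = map Some u ++ None :: map Some v /\ perm_eq (u ++ v) l.
Proof.
have mapK q : None \notin q -> q = map Some (pmap id q) :> seq (option T).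
  elim: q => //= -[x|] q IH; rewrite inE //= => /IH{1}->; by [].
move=> pl; have ns : None \in s by rewrite (perm_mem pl) mem_head.
case/splitPr: ns pl => p1 p2 pl.
have {}pl : perm_eq (p1 ++ p2) (map Some l).
  by rewrite -(perm_cons None) (perm_trans _ pl) // -cat1s perm_catCA.
have : None \notin p1 ++ p2 by rewrite (perm_mem pl); apply/mapP=> -[].
rewrite mem_cat negb_or => /andP[/mapK e1 /mapK e2].
exists (pmap id p1), (pmap id p2); split; first by rewrite -e1 -e2.
by apply: (perm_map_inj Some_inj); rewrite map_cat -e1 -e2.
Qed.

(** * Classes of words, and brackets turned into trivalent vertices *)

Section WordClass.
Variables (K : fieldType) (n d : nat).

(** The default value 0 of [preclass] is essential: it kills the words that omit or repeat a
    univalent half-edge. *)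
Definition wclass N (r f : {perm 'I_N}) (w : word ('I_n * 'I_N)%type) :
  jacobi_space K n d := preclass K d (wdiag r f w).

Definition wev N (r f : {perm 'I_N}) : free_ring ('I_n * 'I_N)%type ->
  jacobi_space K n d := free_ext (wclass r f).

Lemma wclass0 N (r f : {perm 'I_N}) w :
  ~~ is_jacobi (wdiag r f w) d -> wclass r f w = 0.
Proof. by move=> h; rewrite /wclass /preclass insubF //; apply: negbTE. Qed.

Lemma wev_sign N (r f : {perm 'I_N}) (e : bool) z :
  wev r f ((-1) ^+ e * z) = (-1) ^+ e *: wev r f z.
Proof.
case: e; last by rewrite !expr0 mul1r scale1r.
by rewrite !expr1 mulN1r scaleN1r /wev raddfN.
Qed.

Lemma wevB N (r f : {perm 'I_N}) x y : wev r f (x - y) = wev r f x - wev r f y.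
Proof. exact: raddfB. Qed.

Lemma wev_word N (r f : {perm 'I_N}) w :
  wev r f (\prod_(x <- w) gen x) = wclass r f w.
Proof. by rewrite prod_gen /wev free_extU. Qed.

Lemma wev_evalue (X : eqType) N (r f : {perm 'I_N}) s
    (h : X -> free_ring ('I_n * 'I_N)%type) :
  wev r f (evalue h s) =
  \sum_(p <- s) (-1) ^+ p.1 *: wev r f (\prod_(x <- p.2) h x).
Proof.
by rewrite /evalue /wev raddf_sum; apply: eq_bigr => p _; rewrite -wev_sign.
Qed.

Section Cherry.
Variables (N : nat) (r f : {perm 'I_N}) (a b : 'I_N).
Hypotheses (ab : a != b) (ra : r a = a) (rb : r b = b).

(** This is the STU relation read backwards: the two orders of [a] and [b] resolve the stem of the
    fused diagram. *)
Lemma wclass_STU (u v : word ('I_n * 'I_N)%type) i :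
    is_jacobi (wdiag r f (u ++ (i, a) :: (i, b) :: v)) d ->
  wclass r f (u ++ (i, a) :: (i, b) :: v) -
  wclass r f (u ++ (i, b) :: (i, a) :: v) =
  wclass (fuse_rot ab ra rb) (fuse_flip f) (wnew u ++ (i, ffoot N) :: wnew v).
Proof.
move=> j1; have j0 := fuse_jacobi ab ra rb i j1.
have j2 : is_jacobi (wdiag r f (u ++ (i, b) :: (i, a) :: v)) d.
  rewrite -(wdiag_perm _ _ _ (w := u ++ (i, a) :: (i, b) :: v)) //.
  apply: perm_map; rewrite perm_cat2l.
  by rewrite -[[:: _, _ & v]]/([:: (i, a)] ++ [:: (i, b)] ++ v) perm_catCA.
rewrite /wclass (preclassE _ j0) (preclassE _ j1) (preclassE _ j2).
(* Both orders are treated at once; the embedding is [fnew], which misses just the stem and the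
   foot. *)
have res s t (j : is_jacobi (wdiag r f (u ++ (i, s) :: (i, t) :: v)) d) :
    @resolution n d (Jacobi j0) (fstem N) [:: fnew s; fnew t] (Jacobi j).
  exists (@fnew N); split.
  - exact: fnew_inj.
  - move=> x; rewrite [hflip _ _]flip_stem !inE.
    apply/codomP/norP => [[h ->]|].
      by rewrite !(eq_sym (fnew h)) fstem_new ffoot_new.
    by case: (fuseP x) => [->|->|[h ->]]; rewrite ?eqxx => -[] //; exists h.
  - move=> h; rewrite /= rot_stem rot_newb !inE !(inj_eq (@fnew_inj N)).
    case: (eqVneq h b) => [->|hb]; first by rewrite rb.
    case: (eqVneq h a) => [->|ha]; first by rewrite ra.
    by rewrite rot_new.
  - by move=> h; rewrite /= flip_new.
  move=> k; rewrite [hflip _ _]flip_stem -/(subst_seq _ _ _) !ffunE.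
  have wn w : subst_seq (ffoot N) [:: fnew s; fnew t]
      [seq x.2 | x <- wnew w & x.1 == k] =
      map (@fnew N) [seq x.2 | x <- w & x.1 == k].
    rewrite subst_seq_notin.
      by rewrite /wnew filter_map -!map_comp.
    apply/mapP=> -[x]; rewrite mem_filter => /andP[_ /mapP[y _ ->]] /eqP.
    by rewrite /= ffoot_new.
  rewrite !filter_cat !map_cat subst_seq_cat wn; congr (_ ++ _).
  rewrite /=; case: (i == k) => //=.
  by rewrite /subst_seq /= eqxx /= -/(subst_seq _ _ _) wn.
apply/esym; apply: (@jacobi_class_STU K d n (Jacobi j0) _ _ (fstem N)) => /=.
- by rewrite rot_stem eq_sym fstem_new.
- by rewrite flip_stem rot_foot.
- by rewrite rot_stem rot_newb; apply: res.
by rewrite rot_stem rot_newb; apply: res.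
Qed.

End Cherry.

(** A diagram records the order of its legs only within each arc. *)
Lemma wclass_arcs N (r f : {perm 'I_N}) (u v : word ('I_n * 'I_N)%type) x y :
    x.1 != y.1 ->
  wclass r f (u ++ x :: y :: v) = wclass r f (u ++ y :: x :: v).
Proof.
move=> xy; congr (preclass _ _ (Prediagram _ _ _)).
apply/ffunP=> k; rewrite !ffunE !filter_cat !map_cat; congr (_ ++ _) => /=.
by case: eqP => [ex|_] //; case: eqP => [ey|_] //; rewrite ex ey eqxx in xy.
Qed.

Lemma filtration_sum (I : eqType) k (s : seq I) (c : I -> K)
    (F : I -> jacobi_space K n d) :
  (forall i, i \in s -> jacobi_filtration k (F i)) ->
  jacobi_filtration k (\sum_(i <- s) c i *: F i).
Proof.
move=> sF; rewrite big_seq; apply: (big_ind (jacobi_filtration k)).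
- exact: lspan0.
- exact: lspanD.
by move=> i /sF; apply: lspanZ.
Qed.

Lemma filtration0 k : jacobi_filtration k (0 : jacobi_space K n d).
Proof. exact: lspan0. Qed.

Lemma wclass_filtration N (r f : {perm 'I_N}) w :
  jacobi_filtration (ntrivalent (wdiag r f w)) (wclass r f w).
Proof.
have [j|/wclass0->] := boolP (is_jacobi (wdiag r f w) d); last exact: filtration0.
by rewrite /wclass (preclassE _ j); apply: lspan_sub; exists (Jacobi j).
Qed.

(** Induction on the brackets: a cherry on one arc is traded for a trivalent vertex, and a cherry on
    two arcs evaluates to 0. The empty word is a dummy, as [ntrivalent] depends on the rotation
    alone. *)
Lemma wev_forest p N (r f : {perm 'I_N}) (ts : seq (tree ('I_n * 'I_N))) :
    fnodes ts = p ->
  jacobi_filtration (ntrivalent (wdiag r f ([::] : word ('I_n * 'I_N)%type)) + p)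
    (wev r f (fval (@gen _) ts)).
Proof.
elim: p N r f ts => [|p IH] N r f ts ndp.
  rewrite fvalE wev_evalue //; apply: filtration_sum => q _.
  by rewrite wev_word addn0; exact: (wclass_filtration r f q.2).
(* If the leaves do not form a diagram, neither does any word of the expansion. *)
have [j|nj] := boolP (is_jacobi (wdiag r f (fleaves ts)) d); last first.
  suff -> : wev r f (fval (@gen _) ts) = 0 by apply: filtration0.
  rewrite fvalE wev_evalue // big_seq big1 // => q /mem_fexp pq.
  rewrite wev_word wclass0 ?scaler0 //.
  by rewrite (wdiag_perm _ _ _ (perm_map _ pq)).
have [r3 _ cnt _ _] := wdiag_jacobiP _ _ _ _ j.
have [|[i a] [[i' b] [ts' [l [tv nd pn pl]]]]] := @forest_cherry _ ts.
  by rewrite ndp.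
(* Univalent half-edges occur once among the leaves and the others never; hence [a] and [b] are
   univalent and distinct. *)
have cE h : ((a == h) + ((b == h) + count_mem h (map snd l)))%N = (r h == h).
  by rewrite -cnt (seq.permP (perm_map snd pl)).
have ra : r a = a.
  by have := cE a; rewrite eqxx; case: (r a =P a).
have rb : r b = b.
  by have := cE b; rewrite eqxx addnCA; case: (r b =P b).
have ab : a != b.
  by apply/eqP=> e; have := cE a; rewrite -e eqxx ra eqxx.
have expand : wev r f (fval (@gen _) ts) =
    \sum_(q <- fexp ts') (-1) ^+ q.1 *:
      wev r f (\prod_(o <- q.2) plug (@gen _) (i, a) (i', b) o).
  by rewrite tv fvalE wev_evalue.
have term q : q \in fexp ts' -> exists u v : word ('I_n * 'I_N)%type,
    [/\ q.2 = map Some u ++ None :: map Some v,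
        is_jacobi (wdiag r f (u ++ (i, a) :: (i', b) :: v)) d
      & wev r f (\prod_(o <- q.2) plug (@gen _) (i, a) (i', b) o) =
        wclass r f (u ++ (i, a) :: (i', b) :: v) -
        wclass r f (u ++ (i', b) :: (i, a) :: v)].
  move=> /mem_fexp /perm_trans/(_ pn)/split_none[u [v [-> uv]]].
  exists u, v; split=> //.
    rewrite -(wdiag_perm _ _ _ (w := fleaves ts)) //; apply: perm_map.
    apply: (perm_trans pl); rewrite perm_sym.
    rewrite -[[:: _, _ & v]]/([:: (i, a); (i', b)] ++ v) perm_catCA.
    by rewrite perm_cat2l.
  by rewrite prod_plug wevB !wev_word.
have [ii'|ii'] := eqVneq i i'; last first.
  suff -> : wev r f (fval (@gen _) ts) = 0 by apply: filtration0.
  rewrite expand big_seq big1 // => q /term[u [v [_ _ ->]]].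
  by rewrite wclass_arcs // subrr scaler0.
(* Letters move to the fused graph, and the hole becomes its foot, on the common arc of [a] and
   [b]. *)
pose g (o : option ('I_n * 'I_N)) : 'I_n * 'I_(fuse_size N) :=
  if o is Some x then (x.1, fnew x.2) else (i, ffoot N).
have -> : wev r f (fval (@gen _) ts) =
    wev (fuse_rot ab ra rb) (fuse_flip f) (fval (@gen _) (map (tmap g) ts')).
  rewrite expand fval_tmap fvalE [RHS]wev_evalue.
  apply: eq_big_seq => q /term[u [v [eq2 j' ->]]]; congr (_ *: _).
  subst i'; rewrite wclass_STU // eq2 -wev_word !big_cat !big_cons.
  by rewrite !big_map.
rewrite addnS -addSn -[in X in jacobi_filtration X](fuse_trivalent ab ra rb r3).
by apply: IH; rewrite fnodes_tmap; move: ndp; rewrite nd => -[].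
Qed.

Lemma filtration_leq k l (u : jacobi_space K n d) :
  (k <= l)%N -> jacobi_filtration l u -> jacobi_filtration k u.
Proof.
move=> kl; elim=> [|c v w [D kD ->] _ IH]; first exact: filtration0.
by apply: lspanDZ => //; exists D => //; apply: leq_trans kD.
Qed.

Lemma wev_cfil N (r f : {perm 'I_N}) p z :
    cfil snd (@gen ('I_n * 'I_N)%type) p z ->
  jacobi_filtration (ntrivalent (wdiag r f ([::] : word ('I_n * 'I_N)%type)) + p)
    (wev r f z).
Proof.
elim=> [|e _ y [ts dp ->] _ IH]; first by rewrite /wev raddf0; apply: filtration0.
rewrite /wev raddfD /= -!/(wev _ _ _) wev_sign; apply: lspanD IH; apply: lspanZ.
case/orP: dp => [pts|nu].
  apply: filtration_leq (wev_forest r f (erefl (fnodes ts))).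
  by rewrite leq_add2l.
rewrite fvalE wev_evalue //; apply: filtration_sum => q /mem_fexp pq.
rewrite wev_word wclass0; first exact: filtration0.
apply: contra nu => /wdiag_jacobiP[_ _ cnt _ _].
rewrite -(perm_uniq (perm_map snd pq)); apply: count_mem_uniq => h.
by rewrite -has_pred1 has_count cnt; case: eqP.
Qed.

End WordClass.

(** * Cabling as an evaluation *)

Section SubsetExpansion.
Variables (I : finType) (V : pzRingType).
Implicit Types (s : seq I) (S : {set I}).

(** Choosing 1 or [F i] in each factor amounts to choosing a subset, whose factors keep the order of
    [s]. *)
Lemma prod_1D s (F : I -> V) : uniq s ->
  \prod_(i <- s) (1 + F i) =
  \sum_(S : {set I} | S \subset s) \prod_(i <- [seq i <- s | i \in S]) F i.
Proof.
elim: s => [_|i s IH /= /andP[ni us]].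
  rewrite big_nil (big_pred1 set0) ?big_nil // => S.
  by rewrite /= -subset0; apply: eq_subset_r => x; rewrite !inE.
rewrite big_cons mulrDl mul1r IH // [RHS](bigID (fun S : {set I} => i \in S)) /=.
rewrite addrC; congr (_ + _).
  apply: eq_big => [S|S Ss].
    apply/idP/andP => [Ss|[/subsetP Ss iS]].
      split; last by apply: contra ni; apply: (subsetP Ss).
      by apply/subsetP=> x /(subsetP Ss); rewrite inE => ->; rewrite orbT.
    apply/subsetP=> x xS; have := Ss x xS; rewrite inE.
    by case: eqP => // e; rewrite -e xS in iS.
  case: ifP => // iS; case/negP: ni; exact: subsetP Ss _ iS.
rewrite mulr_sumr [RHS](reindex_onto (fun S => i |: S)%SET (fun S => S :\ i)%SET) /=.
  apply: eq_big => [S|S Ss].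
    rewrite setU11 andbT; apply/idP/andP => [Ss|[/subsetP Ss /eqP e]].
      split.
        apply/subsetP=> x; rewrite !inE; case: eqP => //= _.
        exact: (subsetP Ss).
      rewrite setU1K //; apply: contra ni; exact: (subsetP Ss).
    apply/subsetP=> x xS; have iS : i \notin S by rewrite -e !inE eqxx.
    have := Ss x; rewrite !inE xS orbT => /(_ isT).
    by case: eqP => // ex; rewrite -ex xS in iS.
  rewrite setU11 big_cons; congr (_ * _).
  suff -> : [seq x <- s | x \in (i |: S)%SET] = [seq x <- s | x \in S] by [].
  apply: eq_in_filter => x xs; rewrite !inE; case: eqP => // e.
  by rewrite -e xs in ni.
by move=> S /andP[_ iS]; rewrite setD1K.
Qed.

Lemma prod_sign (J : Type) (s : seq J) (e : pred J) (F : J -> V) :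
  \prod_(j <- s) ((-1) ^+ e j * F j) = (-1) ^+ odd (count e s) * \prod_(j <- s) F j.
Proof.
elim: s => [|j s IH]; first by rewrite !big_nil mul1r.
rewrite !big_cons IH /= oddD signr_addb oddb -!mulrA; congr (_ * _).
by rewrite !mulrA; congr (_ * _); apply: commr_sign.
Qed.

End SubsetExpansion.

Lemma uniq_map_inj (T1 T2 : eqType) (g : T1 -> T2) s :
  uniq (map g s) -> {in s &, injective g}.
Proof.
elim: s => //= x s IH /andP[nx us] y z; rewrite !inE.
case/predU1P=> [->|ys]; case/predU1P=> [->|zs] // e.
- by case/negP: nx; rewrite e map_f.
- by case/negP: nx; rewrite -e map_f.
exact: IH.
Qed.

Lemma jacobi_wdiag_uniq n d N (r f : {perm 'I_N}) (w : seq ('I_n * 'I_N)) :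
  is_jacobi (wdiag r f w) d -> uniq (map snd w).
Proof.
case/wdiag_jacobiP=> _ _ cnt _ _; apply: count_mem_uniq => h.
by rewrite -has_pred1 has_count cnt; case: eqP.
Qed.

Lemma legs_uniq n d (D : jacobi n d) i : uniq (legs D i).
Proof.
apply: count_mem_uniq => h; rewrite -has_pred1 has_count.
have /and5P[_ _ /forallP/(_ h)/eqP + _ _] := valP D.
rewrite (bigD1 i) //=; case: (count_mem _ _) => // k.
by rewrite addSn; case: (_ == h) => // -[/eqP]; rewrite addn_eq0 => /andP[/eqP->].
Qed.

(** * Placings as terms of an expanded product *)

Section Cable.
Variables (K : fieldType) (m n d : nat).
Variables (w : 'I_n -> seq (letter m)) (D : jacobi m d).
Local Notation N := (nhalf D).
Local Notation slot := (slot w).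
Local Notation gn := (@gen ('I_n * 'I_N)%type).

Definition letter_legs (a : letter m) : seq 'I_N :=
  if a.2 then legs D a.1 else rev (legs D a.1).

(** An inverse letter reverses the legs and negates them, as a reversed copy of an arc does in the
    action. *)
Definition letter_val (j : 'I_n) (a : letter m) : free_ring ('I_n * 'I_N)%type :=
  \prod_(h <- letter_legs a) (1 + (-1) ^+ (~~ a.2) * gn (j, h)).

Let slots : seq slot :=
  [seq Tagged (fun j => 'I_(size (w j))) p |
    j <- enum 'I_n, p <- rev (enum 'I_(size (w j)))].

(** All possible positions of legs, in the order in which they are met along the arcs of the
    target. *)
Let Q : seq (slot * 'I_N) :=
  [seq (s, h) | s <- slots, h <- letter_legs (slot_letter s)].

Let neg (q : slot * 'I_N) : bool := ~~ (slot_letter q.1).2.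
Let arc_leg (q : slot * 'I_N) : 'I_n * 'I_N := (tag q.1, q.2).

Let mem_slots s : s \in slots.
Proof.
case: s => j p; apply/allpairsPdep; exists j, p.
by rewrite mem_rev !mem_enum.
Qed.

Let memQ s h : ((s, h) \in Q) = (h \in legs D (slot_letter s).1).
Proof.
have lE : (h \in letter_legs (slot_letter s)) = (h \in legs D (slot_letter s).1).
  by rewrite /letter_legs; case: ifP => // _; rewrite mem_rev.
rewrite -lE; apply/allpairsPdep/idP => [[s' [h' [_ hs [-> ->]]]] //|hs].
by exists s, h.
Qed.

Let Q_uniq : uniq Q.
Proof.
apply: allpairs_uniq_dep => [|s _|[s h] [s' h'] _ _ [-> ->]] //.
  apply: allpairs_uniq_dep => [|j _|[j p] [j' p'] _ _ /= e] //.
  - exact: enum_uniq.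
  - by rewrite rev_uniq enum_uniq.
rewrite /letter_legs; case: ifP => _; rewrite ?rev_uniq; exact: legs_uniq.
Qed.

Lemma cable_holonomyE :
  \prod_(j <- enum 'I_n) holonomy (letter_val j) (w j) =
  \prod_(q <- Q) (1 + (-1) ^+ neg q * gn (arc_leg q)).
Proof.
rewrite big_allpairs_dep /= big_allpairs_dep /=; apply: eq_bigr => j _.
rewrite /holonomy -[X in rev X](map_tnth_enum (in_tuple (w j))) -map_rev big_map.
by [].
Qed.

(* A set of (slot, half-edge) pairs yields a diagram only if it is the graph of
   a placing. *)
Let slot_graph (c : {ffun 'I_N -> option slot}) : {set slot * 'I_N} :=
  [set q | c q.2 == Some q.1].
Let slot_choice (S : {set slot * 'I_N}) : {ffun 'I_N -> option slot} :=
  [ffun h => [pick s | (s, h) \in S]].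

Let slot_choiceK c : slot_choice (slot_graph c) = c.
Proof.
apply/ffunP=> h; rewrite ffunE; case: pickP => [s|no].
  by rewrite inE => /eqP.
by case e: (c h) => [s|] //; have := no s; rewrite inE /= e eqxx.
Qed.

Let sub_diag (S : {set slot * 'I_N}) : prediagram n :=
  wdiag (hrot D) (hflip D) (map arc_leg [seq q <- Q | q \in S]).

(** A Jacobi word uses a half-edge at most once, so [S] is the graph of a partial function. *)
Let slot_graphK (S : {set slot * 'I_N}) :
  S \subset Q -> is_jacobi (sub_diag S) d -> slot_graph (slot_choice S) = S.
Proof.
move=> /subsetP SQ /jacobi_wdiag_uniq; rewrite -map_comp => /uniq_map_inj inj.
apply/setP=> -[s h]; rewrite inE ffunE /=; case: pickP => [s' s'S|->] //.
apply/eqP/idP => [[<-]//|sS].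
have mS q : q \in S -> q \in [seq q <- Q | q \in S].
  by move=> qS; rewrite mem_filter qS SQ.
by have [->] := inj _ _ (mS _ s'S) (mS _ sS) erefl.
Qed.

Let slot_graph_legs (c : {ffun 'I_N -> option slot}) :
  sub_diag (slot_graph c) = preplace c.
Proof.
congr Prediagram; apply/ffunP=> j; rewrite !ffunE /place_legs.
have flat (J : eqType) (T : Type) (X : J -> seq T) (j0 : J) s :
    flatten [seq if i == j0 then X i else [::] | i <- s] =
    flatten [seq X i | i <- s & i == j0].
  by elim: s => //= i s ->; case: eqP.
transitivity (flatten [seq if tag s == j then slot_legs (legs D) c s else [::]
  | s <- slots]).
  rewrite filter_map -map_comp -filter_predI filter_flatten map_flatten -!map_comp.
  congr flatten; apply: eq_map => s /=.
  rewrite filter_map -map_comp map_id_in //.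
  rewrite /slot_legs /letter_legs /preim /=.
  case: (slot_letter s) => i e; case: (tag s == j) => /=.
    rewrite (eq_filter (a2 := fun h => c h == Some s)); last first.
      by move=> h /=; rewrite inE.
    by case: e => //; rewrite filter_rev.
  by rewrite filter_pred0.
have flat2 (T : Type) (ss : seq (seq (seq T))) :
    flatten (flatten ss) = flatten (map flatten ss).
  by elim: ss => //= s ss <-; rewrite flatten_cat.
rewrite map_flatten flat2 -2!map_comp /=.
rewrite (eq_map (g := fun i => if i == j then flatten [seq slot_legs (legs D) c
   (Tagged (fun j => 'I_(size (w j))) p) | p <- rev (enum 'I_(size (w i)))] else [::])).
  rewrite flat; have -> : [seq i <- enum 'I_n | i == j] = [:: j].
    exact: filter_pred1_uniq (enum_uniq 'I_n) (mem_enum _ j).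
  by rewrite /= cats0.
move=> i /=; rewrite -map_comp.
by case e: (i == j); elim: (rev _) => //= p s ->; rewrite e.
Qed.

Let slot_graph_placing c :
  (slot_graph c \subset Q) && is_jacobi (sub_diag (slot_graph c)) d =
  (c \in @placings m n w D).
Proof.
apply/andP/idP => [[/subsetP sQ]|cP].
  case/wdiag_jacobiP=> _ _ cnt _ _; apply/forallP=> h.
  case e: (c h) => [s|]; first by rewrite -memQ; apply: sQ; rewrite inE e.
  apply/negP=> fixed_h; have := cnt h; rewrite fixed_h => c1.
  have : h \in map snd (map arc_leg [seq q <- Q | q \in slot_graph c]).
    by rewrite -has_pred1 has_count c1.
  rewrite -map_comp => /mapP[[s h'] + /= eh].
  by rewrite mem_filter inE /= -eh e.
rewrite slot_graph_legs preplace_jacobi //; split=> //.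
apply/subsetP=> -[s h]; rewrite inE memQ /= => /eqP e.
by move/forallP: cP => /(_ h); rewrite e.
Qed.

Let slot_graph_sign c : c \in @placings m n w D ->
  (-1) ^+ odd (count neg [seq q <- Q | q \in slot_graph c]) = place_sign K c.
Proof.
move=> cP; rewrite signr_odd /place_sign; congr (_ ^+ _).
rewrite -size_filter -(size_map snd) -filter_predI.
set s := map _ _; have /card_uniqP <- : uniq s.
  rewrite map_inj_in_uniq ?filter_uniq // => -[t h] [t' h'].
  rewrite !mem_filter /= !inE /=.
  move=> /andP[/andP[_ /eqP e] _] /andP[/andP[_ /eqP e'] _] ehh.
  by move: e e'; rewrite ehh => -> [->].
apply: eq_card => h; rewrite !inE; apply/mapP/idP.
  case=> -[t h'] + ->; rewrite mem_filter /= inE /= => /andP[/andP[nt /eqP->] _].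
  exact: nt.
case e: (c h) => [t|] //= nt; exists (t, h) => //.
rewrite mem_filter /= inE /= e eqxx memQ andbT /neg /= nt.
by move/forallP: cP => /(_ h); rewrite e.
Qed.

(** The product is expanded over subsets of [Q]. Those giving no diagram evaluate to 0, the others
    are the graphs of the placings, and the signs of the inverse letters multiply to
    [place_sign]. *)
Lemma cable_jacobi_wev : cable_jacobi K w D =
  wev K d (hrot D) (hflip D)
    (\prod_(j <- enum 'I_n) holonomy (letter_val j) (w j)).
Proof.
rewrite cable_holonomyE prod_1D // /wev raddf_sum /=.
have tE (S : {set slot * 'I_N}) : wev K d (hrot D) (hflip D)
      (\prod_(q <- [seq q <- Q | q \in S]) ((-1) ^+ neg q * gn (arc_leg q))) =
    (-1) ^+ odd (count neg [seq q <- Q | q \in S]) *: preclass K d (sub_diag S).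
  by rewrite prod_sign wev_sign -(big_map arc_leg xpredT) wev_word.
under [RHS]eq_bigr => S _ do rewrite -/(wev _ _ _ _ _) tE.
rewrite (bigID (fun S => is_jacobi (sub_diag S) d)) /=.
rewrite [X in _ = _ + X]big1 ?addr0; last first.
  by move=> S /andP[_ /wclass0 e]; rewrite [preclass _ _ _]e scaler0.
rewrite (reindex_onto slot_graph slot_choice); last by move=> S /andP[]; apply: slot_graphK.
rewrite cable_jacobiE; apply: eq_big => [c|c cP].
  by rewrite slot_choiceK eqxx andbT slot_graph_placing.
by rewrite [in RHS]slot_graph_legs -(slot_graph_sign cP).
Qed.

End Cable.

(** * The bracket of a diagram with an endomorphism *)

Section Bracket.
Variables (K : fieldType) (n d : nat).

(** Here each arc carries the word of its own generator. Only the full subset of legs gives a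
    diagram, since any other one misses a leg. *)
Lemma jacobi_class_wev (D : jacobi n d) :
  jacobi_class K D = wev K d (hrot D) (hflip D)
    (\prod_(j <- enum 'I_n) letter_val D j (j, true)).
Proof.
pose Q := [seq (j, h) | j <- enum 'I_n, h <- legs D j].
have QD : wdiag (hrot D) (hflip D) Q = D.
  case: (jdiag D) @Q => N r f L Q; congr Prediagram; apply/ffunP=> j.
  rewrite ffunE filter_flatten map_flatten -2!map_comp.
  transitivity (flatten [seq L i | i <- enum 'I_n & i == j]).
    elim: (enum 'I_n) => //= i s ->; case: (eqVneq i j) => [->|/negbTE ij] /=.
      by congr (_ ++ _); elim: (L j) => //= h l IH; rewrite eqxx /= IH.
    by elim: (L i) => //= h l; rewrite ij.
  have -> : [seq i <- enum 'I_n | i == j] = [:: j].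
    exact: filter_pred1_uniq (enum_uniq 'I_n) (mem_enum _ j).
  by rewrite /= cats0.
have QJ : is_jacobi (wdiag (hrot D) (hflip D) Q) d by rewrite QD; exact: valP D.
have Q_uniq := map_uniq (jacobi_wdiag_uniq QJ).
have -> : \prod_(j <- enum 'I_n) letter_val D j (j, true) =
    \prod_(q <- Q) (1 + gen q).
  rewrite big_allpairs_dep /=; apply: eq_bigr => j _; apply: eq_bigr => h _.
  by rewrite mul1r.
rewrite prod_1D // /wev raddf_sum /= (bigD1 [set q in Q]) /=; last first.
  by apply/subsetP=> q; rewrite inE.
rewrite [X in _ = _ + X]big1 ?addr0 => [|S /andP[/subsetP SQ neS]].
  have -> : [seq q <- Q | q \in [set q in Q]] = Q.
    by apply/all_filterP/allP=> q; rewrite inE.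
  rewrite -/(wev _ _ _ _ _) wev_word /wclass (preclassE _ QJ).
  by congr jacobi_class; apply: val_inj; rewrite /= QD.
rewrite -/(wev _ _ _ _ _) wev_word; apply: wclass0; apply: contra neS => SJ.
have [_ _ cS _ _] := wdiag_jacobiP _ _ _ _ SJ.
have [_ _ cQ _ _] := wdiag_jacobiP _ _ _ _ QJ.
(* Both words contain each univalent half-edge once, so they have equal length and the filter keeps
   everything. *)
have /perm_size : perm_eq (map snd [seq q <- Q | q \in S]) (map snd Q).
  by apply/allP=> h _ /=; rewrite cS cQ.
rewrite !size_map size_filter => /eqP; rewrite -all_count => /allP QS.
by apply/eqP/setP=> q; rewrite inE; apply/idP/idP => [/SQ|/QS].
Qed.

Lemma bracket_linear (g : {multiplicative freegroup n -> freegroup n}) c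
    (u v : jacobi_space K n d) :
  bracket (c *: u + v) g = c *: bracket u g + bracket v g.
Proof.
by rewrite /bracket /jacobi_map linearP /= opprD addrACA scalerBr.
Qed.

Lemma bracket_class (g : {multiplicative freegroup n -> freegroup n}) r
    (D : jacobi n d) :
  andreadakis r g ->
  jacobi_filtration (ntrivalent D + r) (bracket (jacobi_class K D) g).
Proof.
move=> gr; pose w j := fgword (g (fggen j)).
(* Both terms are evaluations on the same graph, so the bracket evaluates a difference of products
   of holonomies, to be compared arc by arc. *)
have -> : bracket (jacobi_class K D) g = wev K d (hrot D) (hflip D)
    (\prod_(j <- enum 'I_n) holonomy (letter_val D j) (w j) -
     \prod_(j <- enum 'I_n) holonomy (letter_val D j) (fggen j)).
  rewrite wevB /bracket /jacobi_map cable_class cable_jacobi_wev jacobi_class_wev.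
  congr (_ - wev _ _ _ _ _); apply: eq_bigr => j _.
  by rewrite /holonomy big_seq1.
have val0 j (a : letter n) :
    cfil snd (@gen ('I_n * 'I_(nhalf D))%type) 0 (letter_val D j a).
  apply: cfil0_prod => h; apply: zspanD; first exact: cfil0_1.
  exact/zspan_sign/cfil0_gen.
have valK j (a : letter n) : cnull snd (@gen ('I_n * 'I_(nhalf D))%type)
    (letter_val D j a * letter_val D j (linv a) - 1).
  rewrite /letter_val.
  have -> : letter_legs D (linv a) = rev (letter_legs D a).
    by case: a => i [] //; rewrite /letter_legs /= revK.
  have := @cnull_inverse _ _ snd _ (@gen ('I_n * 'I_(nhalf D))%type)
    [seq (j, h) | h <- letter_legs D a] (~~ a.2).
  by rewrite -map_rev !big_map.
apply: wev_cfil; apply: cfil_prodB => j.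
- exact: cfil0_holonomy.
- exact: cfil0_holonomy.
(* The factor g(x_j) x_j^-1 lies in Gamma_(r+1) by hypothesis, so its holonomy is 1 modulo step
   [r]. *)
have -> : w j = (g (fggen j) * (fggen j)^-1 * fggen j)%g by rewrite mulgVK.
apply: holonomy_mulB => //; exact: gr.
Qed.

End Bracket.

Theorem theorem1p1 (K : fieldType) (charK : [pchar K] =i pred0)
    (d k n r : nat) (r_ge1 : (1 <= r)%N) (u : jacobi_space K n d)
    (g : {multiplicative freegroup n -> freegroup n}) :
  jacobi_filtration k u -> andreadakis r g ->
  jacobi_filtration (k + r) (bracket u g).
Proof.
move=> uk gr; elim: uk => [|c v w [D kD ->] _ IH].
  by rewrite /bracket /jacobi_map linear0 subrr; apply: filtration0.
rewrite bracket_linear; apply: lspanD IH; apply: lspanZ.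
exact: filtration_leq (leq_add kD (leqnn r)) (bracket_class K D gr).
Qed.
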